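(* The Hardy algebra $F^\infty(\mathcal V^{\mathbf m}_{\mathbf f,\mathcal Q_c})$ is reflexive.
   Context: Fix $k\ge 1$ and $(n_1,\dots,n_k)$, $\mathbf m=(m_1,\dots,m_k)$ in $\mathbb N^k$, $\mathbb N=\{1,2,\dots\}$. $\mathbb F^+_{n_i}$ is the free unital semigroup on generators $g^i_1,\dots,g^i_{n_i}$ with identity $g^i_0$; $|\alpha|$ is word length. For indeterminates write $Z_{i,\alpha}=Z_{i,j_1}\cdots Z_{i,j_p}$ if $\alpha=g^i_{j_1}\cdots g^i_{j_p}$. $\mathbb C[Z_{i,j}]$ is the algebra of polynomials in indeterminates $Z_{i,j}$ ($1\le i\le k$, $1\le j\le n_i$), where $Z_{i,1},\dots,Z_{i,n_i}$ are noncommuting and $Z_{s,j},Z_{t,l}$ commute for $s\ne t$. $\mathbf f=(f_1,\dots,f_k)$, where each $f_i=\sum_{\alpha\in\mathbb F^+_{n_i}}a_{i,\alpha}Z_{i,\alpha}$ is a positive regular free holomorphic function: $a_{i,\alpha}\ge0$, $a_{i,g^i_0}=0$, $a_{i,g^i_j}>0$ for $1\le j\le n_i$, and $\limsup_{p\to\infty}(\sum_{|\alpha|=p}|a_{i,\alpha}|^2)^{1/2p}<\infty$. $F^2(H_{n_i})=\mathbb C1\oplus\bigoplus_{p\ge1}H_{n_i}^{\otimes p}$ is the full Fock space over an $n_i$-dimensional Hilbert space, with orthonormal basis $\{e^i_\alpha\}_{\alpha\in\mathbb F^+_{n_i}}$, $e^i_{g^i_0}=1$. Set $b^{(m_i)}_{i,g^i_0}=1$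 and $b^{(m_i)}_{i,\alpha}=\sum_{p=1}^{|\alpha|}\sum_{\gamma_1\cdots\gamma_p=\alpha,\,|\gamma_s|\ge1}a_{i,\gamma_1}\cdots a_{i,\gamma_p}\binom{p+m_i-1}{m_i-1}$ for $|\alpha|\ge1$; $W_{i,j}e^i_\alpha=\sqrt{b^{(m_i)}_{i,\alpha}/b^{(m_i)}_{i,g^i_j\alpha}}\;e^i_{g^i_j\alpha}$; $\mathbf W_{i,j}=I\otimes\cdots\otimes W_{i,j}\otimes\cdots\otimes I$ ($i$-th factor) on $\otimes_{i=1}^kF^2(H_{n_i})$. $\mathcal Q_c$ is the left ideal of $\mathbb C[Z_{i,j}]$ generated by all $Z_{i,j_1}Z_{i,j_2}-Z_{i,j_2}Z_{i,j_1}$, $1\le i\le k$, $1\le j_1,j_2\le n_i$; $\mathcal M_{\mathcal Q_c}$ is the closed linear span of the ranges of $g(\mathbf W)$, $g\in\mathcal Q_c$; $\mathcal N_{\mathcal Q_c}=[\otimes_iF^2(H_{n_i})]\ominus\mathcal M_{\mathcal Q_c}$; $\mathbf L_{i,j}=P_{\mathcal N_{\mathcal Q_c}}\mathbf W_{i,j}|_{\mathcal N_{\mathcal Q_c}}$. $F^\infty(\mathcal V^{\mathbf m}_{\mathbf f,\mathcal Q_c})\subset B(\mathcal N_{\mathcal Q_c})$ is the WOT-closed algebra generated by all $\mathbf L_{i,j}$ and the identity. An algebra $\mathcal U\subset B(\mathcal H)$ is reflexive if $\mathcal U=\mathrm{Alg\,Lat}\,\mathcal U$, where $\mathrm{Lat}\,\mathcal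 U$ is the set of closed subspaces invariant under every $A\in\mathcal U$ and $\mathrm{Alg}\,\mathcal S$ is the set of $A\in B(\mathcal H)$ leaving every member of $\mathcal S$ invariant. *)

(* Defs.v *)
From HB Require Import structures.
From mathcomp Require Import all_boot all_order all_algebra.
From mathcomp Require Import ring lra complex.
From mathcomp Require Import all_classical all_reals all_analysis.
From mathcomp Require Import finmap.
From mathcomp Require Import -(notations) monalg.

Set Implicit Arguments.
Unset Strict Implicit.
Unset Printing Implicit Defensive.

Import Order.TTheory GRing.Theory Num.Theory numFieldNormedType.Exports.

Local Open Scope classical_set_scope.
Local Open Scope ring_scope.
Local Open Scope complex_scope.

(* Inner products are linear in the first argument, and the norm of a normed
   module over R[i] takes its values in R[i]. *)
HB.mixin Record NormedModule_hasInner (R : realType) H of NormedModule R[i] H := {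
  inner : {dot H for @Num.conj R[i]};
  inner_normE : forall x : H, inner x x = `|x| ^+ 2 }.

#[short(type="innerProductType")]
HB.structure Definition InnerProduct (R : realType) :=
  {H of NormedModule R[i] H & NormedModule_hasInner R H}.

HB.factory Record Lmodule_hasInner (R : realType) H of GRing.Lmodule R[i] H := {
  inner : {dot H for @Num.conj R[i]} }.

HB.builders Context R H of Lmodule_hasInner R H.

Local Notation "''[' u , v ]" := (inner u%R v%R).
Local Notation "''[' u ]" := '[u, u].

Let norm (x : H) : R[i] := sqrtC '[x].

Let CauchySchwarz x y : `|'[x, y]| ^+ 2 <= '[x] * '[y].
Proof.
have [->|y0] := eqVneq y 0.
  by rewrite (linear0r _ x) normr0 expr2 mulr0 mulr_ge0 ?dnorm_ge0.
have yp : 0 < '[y] by rewrite dnorm_gt0.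
pose z := '[y] *: x - '[x, y] *: y.
have : 0 <= '[z] by exact: dnorm_ge0.
have -> : '[z] = '[y] * ('[x] * '[y] - `|'[x, y]| ^+ 2).
  rewrite /z linearBl linearBr/= linearBr/= !linearZl_LR/= !linearZr_LR/=.
  have -> : '[y, x] = Num.conj '[x, y].
    by rewrite [LHS]hermC/= expr0 mul1r.
  rewrite normCK.
  have /CrealP -> : '[y] \is Num.real by rewrite ger0_real// ltW.
  have sE (a b : R[i]) : a *: b = a * b by [].
  by rewrite !sE; ring.
by rewrite pmulr_rge0// subr_ge0.
Qed.

Let norm_ge0 x : 0 <= norm x. Proof. by rewrite sqrtC_ge0 dnorm_ge0. Qed.

Let normK x : norm x ^+ 2 = '[x]. Proof. exact: sqrtCK. Qed.

Let ler_normD x y : norm (x + y) <= norm x + norm y.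
Proof.
rewrite -(@ler_pXn2r _ 2)// ?nnegrE ?addr_ge0// normK sqrrD !normK.
rewrite dnormD [leRHS]addrAC lerD2l.
have -> : '[x, y] + Num.conj '[x, y] = 'Re '[x, y] *+ 2.
  by rewrite (@ReE R[i]) -mulr_natr divfK ?pnatr_eq0.
rewrite ler_wMn2r//.
have /le_trans -> // : 'Re '[x, y] <= `|'[x, y]|.
  exact: (leif_Re_Creal '[x, y]).
rewrite -(@ler_pXn2r _ 2)// ?nnegrE ?mulr_ge0// exprMn !normK.
exact: CauchySchwarz.
Qed.

Let normrZ (l : R[i]) x : norm (l *: x) = `|l| * norm x.
Proof. by rewrite /norm dnormZ rootCMl ?exprn_ge0// sqrCK. Qed.

Let normr0_eq0 x : norm x = 0 -> x = 0.
Proof. by move/eqP; rewrite /norm sqrtC_eq0 dnorm_eq0 => /eqP. Qed.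

HB.instance Definition _ :=
  Lmodule_isNormed.Build R[i] H ler_normD normrZ normr0_eq0.

Let inner_normE (x : H) : inner x x = `|x| ^+ 2. Proof. by rewrite [RHS]normK. Qed.

HB.instance Definition _ := NormedModule_hasInner.Build R H inner_normE.

HB.end.

Section Operators.
Variables (R : realType) (H : innerProductType R).
Implicit Types (K S : set H) (T : H -> H) (U : set (H -> H)).

Definition is_subspace K : Prop :=
  K 0 /\ forall (c : R[i]) x y, K x -> K y -> K (c *: x + y).

Definition closed_subspace K : Prop := is_subspace K /\ closed K.

Definition closed_span S : set H := smallest closed_subspace S.

Definition bounded_op : set (H -> H) := [set T | linear T /\ continuous T].

(* The finite families s and the e > 0 index the basic neighbourhoods of T for
   the weak operator topology. *)
Definition wot_closed U : Prop :=
  forall T, bounded_op T ->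
    (forall (s : seq (H * H)) (e : R[i]), 0 < e ->
       exists2 A, U A & forall p, p \in s -> `|inner (T p.1 - A p.1) p.2| < e) ->
    U T.

Definition operator_algebra U : Prop :=
  [/\ U `<=` bounded_op,
      U (fun=> 0),
      forall (c : R[i]) A B, U A -> U B -> U (fun x => c *: A x + B x)
    & forall A B, U A -> U B -> U (A \o B)].

Definition wot_closed_algebra U : Prop := operator_algebra U /\ wot_closed U.

Definition Lat U : set (set H) :=
  [set K | closed_subspace K /\ forall A, U A -> forall x, K x -> K (A x)].

Definition Alg (L : set (set H)) : set (H -> H) :=
  [set A | bounded_op A /\ forall K, L K -> forall x, K x -> K (A x)].

Definition reflexive_algebra U : Prop := U = Alg (Lat U).

End Operators.

Record subspace (R : realType) (H : innerProductType R) := Subspace {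
  subspace_set :> set H;
  subspaceP : is_subspace subspace_set }.

Section SubspaceType.
Variables (R : realType) (H : innerProductType R) (K : subspace H).

Definition subspace_pred : {pred H} := fun x => x \in (K : set H).

Let subspace_submod : submod_closed subspace_pred.
Proof.
have [K0 KD] := subspaceP K; split; first exact/mem_set.
by move=> c x y /set_mem Kx /set_mem Ky; apply/mem_set/KD.
Qed.

HB.instance Definition _ := GRing.isSubmodClosed.Build R[i] H subspace_pred
  subspace_submod.

Record subspace_type := SubspaceElt {
  subspace_val :> H; _ : subspace_val \in subspace_pred }.

HB.instance Definition _ := [isSub for subspace_val].
HB.instance Definition _ := [Choice of subspace_type by <:].
HB.instance Definition _ := [SubChoice_isSubLmodule of subspace_type by <:].

Definition subspace_inner (x y : subspace_type) : R[i] :=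
  inner (subspace_val x) (subspace_val y).

Let valD : {morph subspace_val : x y / x + y}. Proof. by []. Qed.

Let valZ c : {morph subspace_val : x / c *: x}. Proof. by []. Qed.

Let subspace_inner_bilinear :
  bilinear_for ( *%R : GRing.Scale.law R[i] R[i])
    (@Num.conj R[i] \; *%R : GRing.Scale.law R[i] R[i]) subspace_inner.
Proof.
split=> z c x y; rewrite /subspace_inner valD valZ.
  by rewrite linearDl linearZl_LR.
by rewrite linearDr linearZr_LR.
Qed.

HB.instance Definition _ := bilinear_isBilinear.Build R[i] subspace_type
  subspace_type R[i] _ _ subspace_inner subspace_inner_bilinear.

Let subspace_inner_hermitian (x y : subspace_type) :
  subspace_inner x y = (-1) ^+ false * Num.conj (subspace_inner y x).
Proof. exact: hermC. Qed.

HB.instance Definition _ := isHermitianSesquilinear.Build R[i] subspace_type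
  false (@Num.conj R[i]) subspace_inner subspace_inner_hermitian.

Let subspace_inner_gt0 (x : subspace_type) :
  x != 0 -> 0 < subspace_inner x x.
Proof. by move=> x0; rewrite /subspace_inner dnorm_gt0. Qed.

HB.instance Definition _ := isDotProduct.Build R[i] subspace_type
  subspace_inner subspace_inner_gt0.

HB.instance Definition _ := Lmodule_hasInner.Build R subspace_type
  subspace_inner.

End SubspaceType.

Section OrthogonalComplement.
Variables (R : realType) (H : innerProductType R).

Let orth_subspace (S : set H) :
  is_subspace [set x | forall y, S y -> inner x y = 0].
Proof.
split=> [y _ /=|c x y Sx Sy z Sz /=]; first by rewrite linear0l.
by rewrite linearDl linearZl_LR/= Sx// Sy// mulr0 addr0.
Qed.

Definition orth (S : set H) : subspace H := Subspace (orth_subspace S).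

(* The default value 0 is taken only if x has no orthogonal projection on K; this
   does not happen when H is complete and K is closed. *)
Definition orth_proj (K : subspace H) (x : H) : subspace_type K :=
  xget 0 [set y : subspace_type K | forall z, subspace_set K z -> inner (x - subspace_val y) z = 0].

Definition compression (K : subspace H) (T : H -> H) :
    subspace_type K -> subspace_type K :=
  fun x => orth_proj K (T x).

End OrthogonalComplement.

Definition cabs (R : realType) (z : R[i]) : R := complex.Re `|z|.

Lemma cabsE (R : realType) (z : R[i]) : (cabs z)%:C = `|z|.
Proof. exact/RRe_real/normr_real. Qed.

Section CabsTheory.
Variable R : realType.
Implicit Types z w : R[i].

Lemma cabs_ge0 z : 0 <= cabs z.
Proof. by rewrite -lecR cabsE normr_ge0. Qed.

Lemma cabsM z w : cabs (z * w) = cabs z * cabs w.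
Proof. by apply: (@complexI R); rewrite rmorphM/= !cabsE normrM. Qed.

Lemma cabsD z w : cabs (z + w) <= cabs z + cabs w.
Proof. by rewrite -lecR rmorphD/= !cabsE ler_normD. Qed.

Lemma cabs_conj z : cabs (Num.conj z) = cabs z.
Proof. by apply: (@complexI R); rewrite !cabsE norm_conjC. Qed.

Lemma cabs0 : cabs (0 : R[i]) = 0.
Proof. by apply: (@complexI R); rewrite cabsE normr0. Qed.

Lemma cabsR (r : R) : cabs r%:C = `|r|.
Proof.
by apply: (@complexI R); rewrite cabsE normc_def/= expr0n addr0 sqrtr_sqr.
Qed.

End CabsTheory.

#[export] Hint Extern 0 (is_true (@Order.le _ _ _ (cabs _))) =>
  solve [apply: cabs_ge0] : core.

Section Sums.
Variables (R : realType) (I : choiceType).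
Implicit Types (f g : I -> R) (u v : I -> R[i]).

Definition abs_summable u : Prop :=
  summable setT (fun i => (cabs (u i))%:E).

Definition rsum f : R :=
  fine (\esum_(i in setT) (EFin \o f)^\+%E i) -
  fine (\esum_(i in setT) (EFin \o f)^\-%E i).

(* The sum of an absolutely summable family, with no order on the index set. *)
Definition csum u : R[i] :=
  (rsum (fun i => complex.Re (u i)) +i* rsum (fun i => complex.Im (u i))).

Local Notation rsummable f := (summable setT (EFin \o f)).

Lemma summableR_le f g : (forall i, `|f i| <= `|g i|) ->
  summable setT (EFin \o g) -> summable setT (EFin \o f).
Proof.
move=> fg; apply: le_lt_trans; apply: le_esum => i _ /=.
by rewrite lee_fin.
Qed.

Let esumZ (c : R) f : 0 <= c -> (forall i, 0 <= f i) ->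
  (\esum_(i in setT) (c * f i)%:E = c%:E * \esum_(i in setT) (f i)%:E)%E.
Proof.
move=> c0 f0; rewrite /esum -ereal_supZl//; last first.
  by apply/set0P; exists 0%E, set0; [exact: fsets_set0|rewrite fsbig_set0].
congr ereal_sup; apply/seteqP; split=> [_ [A Af <-]|_ [_ [A Af <-] <-]].
  exists (\sum_(i \in A) (f i)%:E)%E; first by exists A.
  rewrite !fsbig_finite//=; try by case: Af.
  rewrite !sumEFin -EFinM mulr_sumr; congr _%:E.
exists A => //.
  rewrite !fsbig_finite//=; try by case: Af.
  rewrite !sumEFin -EFinM mulr_sumr; congr _%:E.
Qed.

Lemma summableRD f g : summable setT (EFin \o f) -> summable setT (EFin \o g) ->
  summable setT (fun i => (f i + g i)%:E).
Proof.
move=> sf sg; have := summableD sf sg; congr (is_true (_ < _)%E).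
Qed.

Lemma summableRZ c f : summable setT (EFin \o f) ->
  summable setT (fun i => (c * f i)%:E).
Proof.
rewrite /summable => sf.
rewrite (eq_esum (b := fun i => (`|c| * `|f i|)%:E)); last first.
  by move=> i _ /=; rewrite normrM.
by rewrite esumZ// lte_mul_pinfty.
Qed.

Let sfin f : rsummable f -> (forall i, 0 <= f i) ->
  (\esum_(i in setT) (f i)%:E \is a fin_num)%E.
Proof.
move=> sf f0; have := sf; rewrite summableE; congr (is_true (_ \is a fin_num)).
by apply: eq_esum => i _ /=; rewrite ger0_norm.
Qed.

Let rsumE f g : rsummable f -> rsummable g -> (forall i, 0 <= f i) ->
  (forall i, 0 <= g i) -> rsum (fun i => f i - g i) =
  fine (\esum_(i in setT) (f i)%:E) - fine (\esum_(i in setT) (g i)%:E).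
Proof.
move=> sf sg f0 g0.
have hp : (EFin \o (fun i => f i - g i)) = ((EFin \o f) \- (EFin \o g))%E by [].
have sfg : summable setT ((EFin \o f) \- (EFin \o g))%E by exact: summableB.
have fp h : summable [set: I] h -> (\esum_(i in setT) h^\+%E i \is a fin_num)%E.
  move=> /summable_funepos; rewrite summableE.
  congr (is_true (_ \is a fin_num)).
  by apply: eq_esum => i _ /=; rewrite gee0_abs// funepos_ge0.
have fn h : summable [set: I] h -> (\esum_(i in setT) h^\-%E i \is a fin_num)%E.
  move=> /summable_funeneg; rewrite summableE.
  congr (is_true (_ \is a fin_num)).
  by apply: eq_esum => i _ /=; rewrite gee0_abs// funeneg_ge0.
rewrite /rsum hp -!fineB ?fp ?fn ?sfin//.
by rewrite esumB// => i _; rewrite /= lee_fin.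
Qed.

Let rpos f i : Num.max (f i) 0 - Num.max (- f i) 0 = f i.
Proof.
have [f0|f0] := leP 0 (f i).
  by rewrite (@max_r _ _ (- f i)) ?oppr_le0// subr0.
by rewrite (@max_l _ _ (- f i)) ?oppr_ge0 ?ltW// opprK add0r.
Qed.

Let psum f := fine (\esum_(i in setT) (f i)%:E).

Let psumD f g : rsummable f -> rsummable g -> (forall i, 0 <= f i) ->
  (forall i, 0 <= g i) -> psum (fun i => f i + g i) = psum f + psum g.
Proof.
move=> sf sg f0 g0; rewrite /psum.
rewrite -fineD ?sfin//.
rewrite -esumD; last 2 first.
- by move=> i _; rewrite lee_fin.
- by move=> i _; rewrite lee_fin.
by congr fine; apply: eq_esum.
Qed.

Let psumZ c f : 0 <= c -> (forall i, 0 <= f i) -> rsummable f ->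
  psum (fun i => c * f i) = c * psum f.
Proof.
by move=> c0 f0 sf; rewrite /psum esumZ// fineM// sfin.
Qed.

Let fp f := fun i => Num.max (f i) 0.
Let fn f := fun i => Num.max (- f i) 0.

Let fp_ge0 f i : 0 <= fp f i. Proof. by rewrite le_max lexx orbT. Qed.
Let fn_ge0 f i : 0 <= fn f i. Proof. by rewrite le_max lexx orbT. Qed.

Let sfp f : rsummable f -> rsummable (fp f).
Proof.
apply: summableR_le => i; rewrite ger0_norm// ge_max ler_norm normr_ge0//.
Qed.

Let sfn f : rsummable f -> rsummable (fn f).
Proof.
apply: summableR_le => i; rewrite ger0_norm// ge_max normr_ge0 andbT.
by rewrite -normrN ler_norm.
Qed.

Let rsumpn f : rsummable f -> rsum f = psum (fp f) - psum (fn f).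
Proof.
move=> sf; rewrite -rsumE//; [|exact: sfp|exact: sfn].
by congr rsum; apply/funext => i; rewrite /fp /fn rpos.
Qed.

Let rsumD f g : rsummable f -> rsummable g ->
  rsum (fun i => f i + g i) = rsum f + rsum g.
Proof.
move=> sf sg; rewrite (rsumpn sf) (rsumpn sg).
have -> : psum (fp f) - psum (fn f) + (psum (fp g) - psum (fn g)) =
  psum (fun i => fp f i + fp g i) - psum (fun i => fn f i + fn g i).
  by rewrite !psumD//; [lra|exact: sfn|exact: sfn|exact: sfp|exact: sfp].
rewrite -rsumE.
- congr rsum; apply/funext => i; rewrite opprD addrACA.
  by rewrite /fp /fn !rpos.
- by apply: summableRD; exact: sfp.
- by apply: summableRD; exact: sfn.
- by move=> i; rewrite addr_ge0.
- by move=> i; rewrite addr_ge0.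
Qed.

Let rsumN f : rsummable f -> rsum (fun i => - f i) = - rsum f.
Proof.
move=> sf; rewrite (rsumpn sf) opprB -rsumE//; [|exact: sfn|exact: sfp].
by congr rsum; apply/funext => i; rewrite -[in LHS](rpos f) opprB.
Qed.

Let rsumZ c f : rsummable f -> rsum (fun i => c * f i) = c * rsum f.
Proof.
have H d : 0 <= d -> rsummable f -> rsum (fun i => d * f i) = d * rsum f.
  move=> d0 sf; rewrite (rsumpn sf) mulrBr -!psumZ//; [|exact: sfn|exact: sfp].
  rewrite -rsumE//.
  - by congr rsum; apply/funext => i; rewrite -mulrBr /fp /fn rpos.
  - by apply/summableRZ/sfp.
  - by apply/summableRZ/sfn.
  - by move=> i; rewrite mulr_ge0.
  - by move=> i; rewrite mulr_ge0.
move=> sf; have [c0|c0] := leP 0 c; first exact: H.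
rewrite -[c in RHS]opprK mulNr -H ?oppr_ge0 ?ltW// -rsumN; last exact: summableRZ.
by congr rsum; apply/funext => i; rewrite mulNr opprK.
Qed.

Let rsum_ge0E f : rsummable f -> (forall i, 0 <= f i) -> rsum f = psum f.
Proof.
move=> sf f0; rewrite (rsumpn sf).
have -> : fp f = f by apply/funext => i; rewrite /fp max_l.
have -> : psum (fn f) = 0; last by rewrite subr0.
rewrite /psum esum1// => i _; congr _%:E.
by rewrite /fn max_r// oppr_le0.
Qed.

Let le_Re (z : R[i]) : `|complex.Re z| <= `|cabs z|.
Proof. by rewrite [leRHS]ger0_norm ?cabs_ge0// -lecR cabsE; exact: normc_ge_Re. Qed.

Let le_Im (z : R[i]) : `|complex.Im z| <= `|cabs z|.
Proof.
have -> : `|complex.Im z| = `|complex.Re (z * 'i%C)| by rewrite ReiNIm normrN.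
have -> : cabs z = cabs (z * 'i%C).
  apply: (@complexI R); rewrite !cabsE normrM.
  by rewrite [X in _ * X]normc_def/= expr0n expr1n add0r sqrtr1 mulr1.
exact: le_Re.
Qed.

Let sRe u : abs_summable u -> rsummable (fun i => complex.Re (u i)).
Proof. by apply: summableR_le => i; exact: le_Re. Qed.

Let sIm u : abs_summable u -> rsummable (fun i => complex.Im (u i)).
Proof. by apply: summableR_le => i; exact: le_Im. Qed.

Let addcE (a b c d : R) : (a +i* b) + (c +i* d) = (a + c) +i* (b + d).
Proof. by []. Qed.

Let mulcE (a b c d : R) :
  (a +i* b) * (c +i* d) = (a * c - b * d) +i* (a * d + b * c).
Proof. by []. Qed.

Let conjE (a b : R) : Num.conj (a +i* b) = a -i* b.
Proof. by []. Qed.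

Lemma csumD u v : abs_summable u -> abs_summable v ->
  csum (fun i => u i + v i) = csum u + csum v.
Proof.
move=> su sv; rewrite /csum.
rewrite addcE -!rsumD; [|exact: sIm|exact: sIm|exact: sRe|exact: sRe].
by congr (rsum _ +i* rsum _); apply/funext => i; case: (u i) (v i) => ? ? [].
Qed.

Lemma csumZ c u : abs_summable u -> csum (fun i => c * u i) = c * csum u.
Proof.
move=> su; case: c => a b; rewrite /csum mulcE.
have sR d := summableRZ d (sRe su); have sI d := summableRZ d (sIm su).
rewrite -(rsumZ a (sRe su)) -(rsumZ b (sIm su)) -(rsumZ a (sIm su)).
rewrite -(rsumZ b (sRe su)) -(rsumN (sI b)) -(rsumD (sI a) (sR b)).
rewrite -(rsumD (sR a)); last first.
  have := summableRZ (-1) (sI b); congr (summable _ _).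
  by apply/funext => i /=; rewrite mulN1r.
by congr (rsum _ +i* rsum _); apply/funext => i; case: (u i).
Qed.

Lemma csum_conj u : abs_summable u ->
  csum (fun i => Num.conj (u i)) = Num.conj (csum u).
Proof.
move=> su; rewrite /csum conjE -rsumN; last exact: sIm.
by congr (rsum _ +i* rsum _); apply/funext => i; case: (u i).
Qed.

Lemma csum_gt0 u j : abs_summable u -> (forall i, 0 <= u i) -> 0 < u j ->
  0 < csum u.
Proof.
move=> su u0 uj; rewrite /csum.
have im0 : rsum (fun i => complex.Im (u i)) = 0.
  have -> : (fun i => complex.Im (u i)) = (fun i => 0 * complex.Im (u i)).
    by apply/funext => i; rewrite mul0r ger0_Im.
  by rewrite rsumZ ?mul0r//; exact: sIm.
have Re0 i : 0 <= complex.Re (u i) by have := u0 i; rewrite lecE => /andP[].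
rewrite im0 ltcE/= eqxx/= rsum_ge0E//; last exact: sRe.
have ltj : 0 < complex.Re (u j) by move: uj; rewrite ltcE => /andP[].
apply: (lt_le_trans ltj); rewrite /psum -lee_fin fineK; last first.
  by rewrite sfin//; exact: sRe.
apply: esum_ge; exists [set j]; first by split.
by rewrite fsbig_set1.
Qed.

End Sums.

Section Ell2.
Variables (R : realType) (I : choiceType).
Implicit Types x y : I -> R[i].

Definition square_summable x : Prop :=
  summable setT (fun i => (cabs (x i) ^+ 2)%:E).

Lemma square_summable_le (c : R) x y :
  (forall i, cabs (x i) <= c * cabs (y i)) -> square_summable y ->
  square_summable x.
Proof.
move=> xy sy; have := summableRZ (c ^+ 2) sy.
apply: (@summableR_le R I (fun i => cabs (x i) ^+ 2)
  (fun i => c ^+ 2 * cabs (y i) ^+ 2)) => i.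
rewrite -exprMn !ger0_norm ?sqr_ge0//.
by rewrite lerXn2r ?nnegrE ?cabs_ge0// (le_trans _ (xy i)) ?cabs_ge0.
Qed.

Definition square_summable_pred : {pred I -> R[i]} :=
  fun x => `[< square_summable x >].

Record ell2 := Ell2 {
  ell2_val :> I -> R[i]; _ : ell2_val \in square_summable_pred }.

HB.instance Definition _ := [isSub for ell2_val].
HB.instance Definition _ := [Choice of ell2 by <:].

Lemma ell2P (x : ell2) : square_summable x.
Proof. by case: x => x /= /asboolP. Qed.

Lemma square_summable0 : square_summable (fun=> 0).
Proof.
rewrite /square_summable /summable esum1// => i _ /=.
by rewrite cabs0 expr0n normr0.
Qed.

Let square_summable_submod : submod_closed square_summable_pred.
Proof.
split=> [|c x y /asboolP sx /asboolP sy]; apply/asboolP.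
  exact: square_summable0.
have := summableRD (summableRZ (2 * cabs c ^+ 2) sx) (summableRZ 2 sy).
apply: (@summableR_le R I (fun i => cabs (c * x i + y i) ^+ 2)
  (fun i => 2 * cabs c ^+ 2 * cabs (x i) ^+ 2 + 2 * cabs (y i) ^+ 2)) => i.
rewrite !ger0_norm ?addr_ge0 ?mulr_ge0 ?sqr_ge0//.
apply: (@le_trans _ _ ((cabs c * cabs (x i) + cabs (y i)) ^+ 2)).
  rewrite lerXn2r ?nnegrE ?addr_ge0 ?mulr_ge0 ?cabs_ge0//.
  by rewrite -cabsM cabsD.
have := sqr_ge0 (cabs c * cabs (x i) - cabs (y i)); nra.
Qed.

HB.instance Definition _ := GRing.isSubmodClosed.Build R[i] (I -> R[i])
  square_summable_pred square_summable_submod.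
HB.instance Definition _ := [SubChoice_isSubLmodule of ell2 by <:].

Definition ell2_inner (x y : ell2) : R[i] :=
  csum (fun i => x i * Num.conj (y i)).

Let abs_summable_inner (x y : ell2) :
  abs_summable (fun i => x i * Num.conj (y i)).
Proof.
have := summableRD (ell2P x) (ell2P y).
apply: (@summableR_le R I (fun i => cabs (x i * Num.conj (y i)))
  (fun i => cabs (x i) ^+ 2 + cabs (y i) ^+ 2)) => i.
rewrite !ger0_norm ?addr_ge0 ?sqr_ge0 ?cabs_ge0// cabsM cabs_conj.
have := sqr_ge0 (cabs (x i) - cabs (y i)).
have := cabs_ge0 (x i); have := cabs_ge0 (y i); nra.
Qed.

Lemma ell2D (x y : ell2) i : (x + y) i = x i + y i. Proof. by []. Qed.

Lemma ell2Z c (x : ell2) i : (c *: x) i = c * x i. Proof. by []. Qed.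

Let ell2_inner_hermitian (x y : ell2) :
  ell2_inner x y = (-1) ^+ false * Num.conj (ell2_inner y x).
Proof.
rewrite expr0 mul1r /ell2_inner -csum_conj; last exact: abs_summable_inner.
by congr csum; apply/funext => i; rewrite rmorphM/= conjCK mulrC.
Qed.

Let ell2_inner_linear z : GRing.linear_for *%R (ell2_inner ^~ z).
Proof.
move=> c x y; rewrite /ell2_inner -csumZ; last exact: abs_summable_inner.
rewrite -csumD; last 2 first.
- have := abs_summable_inner (c *: x) z; congr abs_summable.
  by apply/funext => i; rewrite ell2Z mulrA.
- exact: abs_summable_inner.
by congr csum; apply/funext => i; rewrite ell2D ell2Z mulrDl mulrA.
Qed.

Let ell2_inner_bilinear :
  bilinear_for ( *%R : GRing.Scale.law R[i] R[i])
    (@Num.conj R[i] \; *%R : GRing.Scale.law R[i] R[i]) ell2_inner.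
Proof.
split=> z c x y; first exact: ell2_inner_linear.
have H u v : ell2_inner u v = Num.conj (ell2_inner v u).
  by rewrite ell2_inner_hermitian mul1r.
by rewrite H ell2_inner_linear rmorphD rmorphM/= -!H.
Qed.

HB.instance Definition _ := bilinear_isBilinear.Build R[i] ell2 ell2 R[i] _ _
  ell2_inner ell2_inner_bilinear.

HB.instance Definition _ := isHermitianSesquilinear.Build R[i] ell2 false
  (@Num.conj R[i]) ell2_inner ell2_inner_hermitian.

Let ell2_inner_gt0 (x : ell2) : x != 0 -> 0 < ell2_inner x x.
Proof.
move=> x0; have [i xi] : exists i, x i != 0.
  apply: contrapT => nx; move/negP: x0; apply; apply/eqP/val_inj/funext => i /=.
  by apply/eqP/negPn/negP => xi; apply: nx; exists i.
apply: (csum_gt0 (j := i)); first exact: abs_summable_inner.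
- by move=> l; exact: mul_conjC_ge0.
- by rewrite mul_conjC_gt0.
Qed.

HB.instance Definition _ := isDotProduct.Build R[i] ell2 ell2_inner ell2_inner_gt0.

HB.instance Definition _ := Lmodule_hasInner.Build R ell2 ell2_inner.

(* to_ell2 x is the element of ell2 with coordinates x; it is 0 when x is not
   square summable. *)
Definition to_ell2 (x : I -> R[i]) : ell2 := insubd 0 x.

Lemma to_ell2E x : square_summable x -> to_ell2 x = x :> (I -> R[i]).
Proof. by move=> sx; rewrite /to_ell2 insubdK//; apply/asboolP. Qed.

Let delta (i j : I) : R[i] := (j == i)%:R.

Let delta_square_summable i : square_summable (delta i).
Proof.
rewrite /square_summable /summable.
rewrite (eq_esum (b := fun j => if j \in [set i] then 1%:E else 0%:E)).
  by rewrite -esum_mkcond esum_set1// ltry.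
move=> j _; rewrite in_set1 /delta.
by case: eqP => _ /=; rewrite ?cabs0 -?[1]/(1%:C) ?cabsR ?normr1 ?expr0n ?expr1n ?normr0 ?normr1.
Qed.

Definition ell2_basis (i : I) : ell2 := to_ell2 (fun j => (j == i)%:R).

Lemma ell2_basisE i j : ell2_basis i j = (j == i)%:R.
Proof. by rewrite /ell2_basis to_ell2E//; exact: delta_square_summable. Qed.

End Ell2.

Section SquareSummablePush.
Variables (R : realType) (I J : choiceType).

Lemma square_summable_comp (s : J -> I) (x : I -> R[i]) :
  injective s -> square_summable x -> square_summable (x \o s).
Proof.
move=> si; apply: le_lt_trans.
rewrite -(@esum_image R J I setT s (fun i => `|(cabs (x i) ^+ 2)%:E|)%E); last first.
  by move=> ? ? _ _ /si.
rewrite esum_mkcond; apply: le_esum => i _.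
by case: ifP.
Qed.

Lemma square_summable_push (s : J -> I) (x : J -> R[i]) (y : I -> R[i]) :
  injective s -> (forall j, y (s j) = x j) -> (forall i, y i != 0 -> range s i) ->
  square_summable x -> square_summable y.
Proof.
move=> si ys y0; apply: le_lt_trans.
have -> : (\esum_(i in [set: J]) `|(cabs (x i) ^+ 2)%:E| =
  \esum_(i in range s) `|(cabs (y i) ^+ 2)%:E|)%E.
  by rewrite esum_image; [apply: eq_esum => j _; rewrite ys | move=> ? ? _ _ /si].
rewrite [leRHS]esum_mkcond; apply: le_esum => i _.
case: ifPn => // ni; have [->|/y0 /mem_set] := eqVneq (y i) 0.
  by rewrite cabs0 expr0n/= normr0.
by rewrite (negPf ni).
Qed.

End SquareSummablePush.

Section Multiwords.
Variables (k : nat) (n : 'I_k -> nat).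

(* The product of the free monoids on n_1, ..., n_k generators: its elements are
   the monomials in noncommuting Z_{i,1}, ..., Z_{i,n_i} such that Z_{s,j} and
   Z_{t,l} commute for s <> t. *)
Definition mword := {dffun forall i : 'I_k, seq 'I_(n i)}.

HB.instance Definition _ := Choice.on mword.

Implicit Types u v w : mword.

Definition mword_one : mword := finfun (fun i => [::]).

Definition mword_mul u v : mword := finfun (fun i => u i ++ v i).

Let mword_mulA : associative mword_mul.
Proof. by move=> u v w; apply/ffunP => i; rewrite !ffunE catA. Qed.

Let mword_mul1 : left_id mword_one mword_mul.
Proof. by move=> u; apply/ffunP => i; rewrite !ffunE. Qed.

Let mword_mulr1 : right_id mword_one mword_mul.
Proof. by move=> u; apply/ffunP => i; rewrite !ffunE cats0. Qed.

Let mword_unitm u v :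
  mword_mul u v = mword_one -> u = mword_one /\ v = mword_one.
Proof.
move=> uv; split; apply/ffunP => i; have := congr1 (fun w : mword => w i) uv;
by rewrite /= !ffunE; case: (u i) => //; case: (v i).
Qed.

HB.instance Definition _ := Choice_isMonomialDef.Build mword mword_mulA
  mword_mul1 mword_mulr1 mword_unitm.

(* w with its i-th component replaced by alpha. *)
Definition mword_set w (i : 'I_k) (alpha : seq 'I_(n i)) : mword :=
  finfun (@dfwith 'I_k (fun l => seq 'I_(n l)) w i alpha).

End Multiwords.

Section Polynomials.
Variables (R : realType) (k : nat) (n : 'I_k -> nat).

Definition Zvar (i : 'I_k) (j : 'I_(n i)) : malg (mword n) R[i] :=
  mkmalgU (mword_set (mword_one n) [:: j]) 1.

Definition left_ideal (A : pzRingType) (J : set A) : Prop :=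
  J 0 /\ forall a x y, J x -> J y -> J (a * x + y).

Definition Qc : set (malg (mword n) R[i]) :=
  smallest (@left_ideal _)
    [set g | exists (i : 'I_k) (j1 j2 : 'I_(n i)),
               g = Zvar j1 * Zvar j2 - Zvar j2 * Zvar j1].

End Polynomials.

Section Weights.
Variables (R : realType) (n : nat).
Implicit Types (a : seq 'I_n -> R) (alpha : seq 'I_n).

Definition positive_regular a : Prop :=
  [/\ forall alpha, 0 <= a alpha,
      a [::] = 0,
      forall j, 0 < a [:: j]
    & (limn_esup (fun p =>
         ((\sum_(alpha : p.-tuple 'I_n) `|a alpha| ^+ 2)
            `^ (2 * p%:R)^-1)%:E) < +oo)%E].

(* gamma_1 ... gamma_p = alpha with |gamma_s| >= 1 for all s. The factors of
   alpha have length at most |alpha|, which makes their type finite. *)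
Definition factorization alpha p (gamma : p.-tuple ((size alpha).-bseq 'I_n)) :=
  (flatten (map val gamma) == alpha) &&
  all (fun u : (size alpha).-bseq 'I_n => (0 < size u)%N) gamma.

Definition weight a (m : nat) alpha : R :=
  if alpha is [::] then 1 else
  \sum_(1 <= p < (size alpha).+1)
    \sum_(gamma : p.-tuple ((size alpha).-bseq 'I_n) | factorization gamma)
      (\prod_(u <- gamma) a u) * 'C(p + m - 1, m - 1)%N%:R.

(* e_alpha |-> sqrt (b_alpha / b_{g_j alpha}) e_{g_j alpha}, in coordinates. For
   the weights above the coefficients are bounded by 1 / sqrt a_{g_j}, so the
   image is square summable: see weighted_shiftE. *)
Definition weighted_shift (b : seq 'I_n -> R) (j : 'I_n)
    (x : ell2 R (seq 'I_n)) : ell2 R (seq 'I_n) :=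
  to_ell2 (fun beta =>
    if beta is l :: alpha then
      if l == j then (Num.sqrt (b alpha / b (j :: alpha)))%:C * x alpha else 0
    else 0).

End Weights.

Section HardyAlgebra.
Variables (R : realType) (k : nat) (n : 'I_k -> nat).

Local Notation H := (ell2 R (mword n)).

(* The full Fock space over an n_i-dimensional space is ell2 R (seq 'I_(n i)),
   with orthonormal basis (e_alpha) = ell2_basis R; the Hilbert tensor product of
   these spaces is ell2 R (mword n), where ell2_basis R w is
   e_{w_1} (x) ... (x) e_{w_k}. On it, ampliation T is
   I (x) ... (x) T (x) ... (x) I with T at the i-th factor: T is applied to the
   i-th coordinate, the others being fixed. See W_basis. *)
Definition slice (i : 'I_k) (w : mword n) (x : H) : ell2 R (seq 'I_(n i)) :=
  to_ell2 (fun beta => x (mword_set w beta)).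

Definition ampliation (i : 'I_k)
    (T : ell2 R (seq 'I_(n i)) -> ell2 R (seq 'I_(n i))) (x : H) : H :=
  to_ell2 (fun w => T (slice i w x) (w i)).

Variables (m : 'I_k -> nat) (a : forall i, seq 'I_(n i) -> R).

Definition W (i : 'I_k) (j : 'I_(n i)) : H -> H :=
  ampliation (weighted_shift (weight (@a i) (m i)) j).

Definition W_word (i : 'I_k) (alpha : seq 'I_(n i)) : H -> H :=
  foldr (fun j T => W j \o T) idfun alpha.

(* The order of the factors is irrelevant, as W i j and W i' j' commute when
   i <> i'. *)
Definition W_mword (w : mword n) : H -> H :=
  foldr (fun i T => W_word (w i) \o T) idfun (enum 'I_k).

Definition W_eval (g : malg (mword n) R[i]) (x : H) : H :=
  \sum_(w <- msupp g) mcoeff w g *: W_mword w x.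

Definition M_Qc : set H := closed_span (\bigcup_(g in @Qc R k n) range (W_eval g)).

Definition N_Qc : subspace H := orth M_Qc.

Definition L_Qc (i : 'I_k) (j : 'I_(n i)) : subspace_type N_Qc -> subspace_type N_Qc :=
  @compression R _ N_Qc (W j).

Definition hardy_algebra : set (subspace_type N_Qc -> subspace_type N_Qc) :=
  smallest (@wot_closed_algebra R (subspace_type N_Qc))
    [set T | T = idfun \/ exists (i : 'I_k) (j : 'I_(n i)), T = L_Qc j].

End HardyAlgebra.

Arguments hardy_algebra {R k n} m a _.

Section WeightTheory.
Variables (R : realType) (n : nat) (a : seq 'I_n -> R) (m : nat).
Hypotheses (a_pos : positive_regular a) (m_gt0 : (0 < m)%N).

Let a_ge0 u : 0 <= a u. Proof. by case: a_pos. Qed.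

Let ler_sum_inj (I J : finType) (f : I -> J) (P : pred I) (Q : pred J)
    (F : J -> R) :
  injective f -> (forall i, P i -> Q (f i)) -> (forall j, 0 <= F j) ->
  \sum_(i | P i) F (f i) <= \sum_(j | Q j) F j.
Proof.
move=> fi PQ F0; rewrite (bigID [pred j | j \in f @: [set i | P i]%SET]) /=.
rewrite (_ : \sum_(j | Q j && (j \in _)) _ = \sum_(i | P i) F (f i)).
  by rewrite lerDl sumr_ge0.
transitivity (\sum_(j in f @: [set i | P i]%SET) F j).
  apply: eq_bigl => j; rewrite andbC; case: imsetP => //= -[i0]; rewrite inE => Pi ->.
  exact: PQ.
rewrite big_imset/=; first by apply: eq_bigl => i; rewrite inE.
by move=> ? ? _ _; exact: fi.
Qed.

Let C p : R := 'C(p + m - 1, m - 1)%N%:R.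

Let C_ge0 p : 0 <= C p. Proof. by []. Qed.

Let C_le p : C p <= C p.+1.
Proof. by rewrite ler_nat leq_bin2l// -!addnBA// leq_add2r. Qed.

Let T p alpha : R :=
  \sum_(gamma : p.-tuple ((size alpha).-bseq 'I_n) | factorization gamma)
      (\prod_(u <- gamma) a u).

Let T_ge0 p alpha : 0 <= T p alpha.
Proof. by apply: sumr_ge0 => g _; apply: prodr_ge0 => u _. Qed.

Let weightE alpha : alpha != [::] ->
  weight a m alpha = \sum_(1 <= p < (size alpha).+1) T p alpha * C p.
Proof.
by case: alpha => // j alpha _; apply: eq_bigr => p _; rewrite -mulr_suml.
Qed.

Let T_cons p j alpha : a [:: j] * T p alpha <= T p.+1 (j :: alpha).
Proof.
pose N := size alpha.
pose wd (u : N.-bseq 'I_n) : N.+1.-bseq 'I_n := widen_bseq (leqnSn N) u.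
pose j1 : N.+1.-bseq 'I_n := @Bseq N.+1 _ [:: j] isT.
pose f (g : p.-tuple (N.-bseq 'I_n)) : p.+1.-tuple (N.+1.-bseq 'I_n) :=
  cons_tuple j1 (map_tuple wd g).
have fi : injective f.
  move=> g1 g2 /(congr1 val) /= [] /inj_map H; apply/val_inj/H => u v /(congr1 val) /=.
  exact: val_inj.
have -> : a [:: j] * T p alpha =
  \sum_(g : p.-tuple (N.-bseq 'I_n) | factorization g) \prod_(u <- f g) a u.
  rewrite mulr_sumr; apply: eq_bigr => g _.
  by rewrite /= big_cons big_map.
apply: (@ler_sum_inj _ _ f _ _ (fun g => \prod_(u <- g) a u)) => //.
- move=> g /andP[/eqP fg ag]; apply/andP; split=> /=.
    by rewrite -map_comp -[X in _ == _ :: X]fg.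
  by rewrite all_map.
- by move=> g; apply: prodr_ge0.
Qed.

Lemma weight_cons j alpha : a [:: j] * weight a m alpha <= weight a m (j :: alpha).
Proof.
rewrite (@weightE (j :: alpha))// big_add1/=.
have [->|alpha0] := eqVneq alpha [::].
  rewrite big_nat1 mulr1; have T0 : T 0 [::] = 1.
    rewrite /T (big_pred1 [tuple]) => [|g]; first exact: big_nil.
    have -> : g = [tuple] by exact: tuple0.
    by rewrite /factorization/= !eqxx.
  apply: (@le_trans _ _ (a [:: j] * T 0 [::] * C 1)).
    rewrite T0 mulr1 ler_peMr ?a_ge0// -[1]/(1%:R) ler_nat bin_gt0.
    by rewrite addKn leq_subr.
  by rewrite ler_wpM2r//; exact: T_cons.
rewrite weightE// big_add1/= mulr_sumr big_nat_recl// ler_wpDl ?mulr_ge0//.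
apply: ler_sum => p _; rewrite mulrA.
apply: (@le_trans _ _ (T p.+2 (j :: alpha) * C p.+1)).
  by rewrite ler_wpM2r//; exact: T_cons.
by rewrite ler_wpM2l//; exact: C_le.
Qed.

Lemma weight_gt0 alpha : 0 < weight a m alpha.
Proof.
elim: alpha => [|j alpha IH]; first exact: ltr01.
apply: lt_le_trans (weight_cons j alpha).
by rewrite mulr_gt0//; case: a_pos.
Qed.

End WeightTheory.

Section ShiftTheory.
Variables (R : realType) (n : nat) (a : seq 'I_n -> R) (m : nat).
Hypotheses (a_pos : positive_regular a) (m_gt0 : (0 < m)%N).
Local Notation b := (weight a m).

Lemma shift_coef_le j alpha :
  cabs (Num.sqrt (b alpha / b (j :: alpha)))%:C <= Num.sqrt (a [:: j])^-1.
Proof.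
have aj : 0 < a [:: j] by case: a_pos.
rewrite cabsR ger0_norm ?sqrtr_ge0// ler_wsqrtr//.
rewrite ler_pdivrMr ?weight_gt0// ler_pdivlMl//.
exact: weight_cons.
Qed.

Lemma weighted_shiftE j (x : ell2 R (seq 'I_n)) (beta : seq 'I_n) :
  weighted_shift b j x beta =
  if beta is l :: alpha then
    if l == j then (Num.sqrt (b alpha / b (j :: alpha)))%:C * x alpha else 0
  else 0.
Proof.
rewrite /weighted_shift to_ell2E//.
apply: (@square_summable_push R _ _ (cons j)
  (fun alpha => (Num.sqrt (b alpha / b (j :: alpha)))%:C * x alpha)).
- by move=> u v [].
- by move=> u; rewrite eqxx.
- by case=> [|l u]; [rewrite eqxx|case: (l =P j) => [-> _|_]; [exists u|rewrite eqxx]].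
- apply: square_summable_le (ell2P x) => u; rewrite cabsM.
  by apply: ler_wpM2r => //; exact: shift_coef_le.
Qed.

End ShiftTheory.

Section MwordTheory.
Variables (k : nat) (n : 'I_k -> nat).
Implicit Types (w : mword n) (i : 'I_k).

Lemma mword_set_in w i (u : seq 'I_(n i)) : mword_set w u i = u.
Proof. rewrite ffunE; exact: (@dfwith_in _ (fun l => seq 'I_(n l))). Qed.

Lemma mword_set_out w i (u : seq 'I_(n i)) i' : i != i' -> mword_set w u i' = w i'.
Proof.
move=> ii'; rewrite ffunE.
exact: (@dfwith_out _ (fun l => seq 'I_(n l))).
Qed.

Lemma mword_set_set w i (u v : seq 'I_(n i)) :
  mword_set (mword_set w u) v = mword_set w v.
Proof.
apply/ffunP => i'; have [<-|ii'] := eqVneq i i'; first by rewrite !mword_set_in.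
by rewrite !mword_set_out.
Qed.

Lemma mword_set_id w i : mword_set w (w i) = w.
Proof.
apply/ffunP => i'; have [<-|ii'] := eqVneq i i'; first by rewrite mword_set_in.
by rewrite mword_set_out.
Qed.

End MwordTheory.

Section WTheory.
Variables (R : realType) (k : nat) (n m : 'I_k -> nat).
Variable a : forall i : 'I_k, seq 'I_(n i) -> R.
Hypotheses (a_pos : forall i, positive_regular (@a i)).
Hypotheses (m_gt0 : forall i, (0 < m i)%N).
Local Notation b i := (weight (@a i) (m i)).

Lemma sliceE (i : 'I_k) (w : mword n) (x : ell2 R (mword n)) beta :
  slice i w x beta = x (mword_set w beta).
Proof.
rewrite /slice to_ell2E//; apply: (square_summable_comp _ (ell2P x)) => u v uv.
by rewrite -(mword_set_in w u) uv mword_set_in.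
Qed.

Lemma WE (i : 'I_k) (j : 'I_(n i)) (x : ell2 R (mword n)) (w : mword n) :
  W m a j x w =
  if w i is l :: alpha then
    if l == j then
      (Num.sqrt (b i alpha / b i (j :: alpha)))%:C * x (mword_set w alpha)
    else 0
  else 0.
Proof.
have WE' v : weighted_shift (b i) j (slice i v x) (v i) =
    if v i is l :: alpha then
      if l == j then
        (Num.sqrt (b i alpha / b i (j :: alpha)))%:C * x (mword_set v alpha)
      else 0
    else 0.
  rewrite weighted_shiftE//; case: (v i) => // l alpha; case: (l =P j) => // _.
  by rewrite sliceE.
rewrite /W /ampliation to_ell2E ?WE'//.
apply: (@square_summable_push R _ _ (fun v => mword_set v (j :: v i))
  (fun v => (Num.sqrt (b i (v i) / b i (j :: v i)))%:C * x v)).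
- move=> u v uv; rewrite -(mword_set_id u i) -(mword_set_id v i).
  have := congr1 (fun w : mword n => w i) uv; rewrite /= !mword_set_in => -[uvi].
  rewrite -(mword_set_set u (j :: u i)) uv uvi mword_set_set.
  by rewrite -uvi.
- by move=> v; rewrite WE' mword_set_in eqxx mword_set_set mword_set_id.
- move=> v; rewrite WE'; case E : (v i) => [|l alpha]; first by rewrite eqxx.
  case: (l =P j) => [lj _|_]; last by rewrite eqxx.
  exists (mword_set v alpha) => //=.
  by rewrite mword_set_in mword_set_set -lj -E mword_set_id.
- apply: square_summable_le (ell2P x) => u; rewrite cabsM.
  by apply: ler_wpM2r => //; exact: shift_coef_le.
Qed.

Lemma W_basis (i : 'I_k) (j : 'I_(n i)) (w : mword n) :
  W m a j (ell2_basis R w) =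
  (Num.sqrt (b i (w i) / b i (j :: w i)))%:C *:
    ell2_basis R (mword_set w (j :: w i)).
Proof.
apply/val_inj/funext => v; rewrite [LHS]WE.
rewrite [RHS]ell2Z ell2_basisE.
case E : (v i) => [|l alpha].
  have [vw|_] := eqVneq v; last by rewrite mulr0n mulr0.
  by move: E; rewrite vw mword_set_in.
case: (l =P j) => [lj|lj].
  rewrite ell2_basisE; have [vw|vw] := eqVneq (mword_set v alpha) w.
    rewrite -vw mword_set_in mword_set_set -lj -E mword_set_id eqxx.
    by rewrite E.
  rewrite mulr0n mulr0; have [vw'|_] := eqVneq v; last by rewrite mulr0n mulr0.
  case/eqP: vw; rewrite vw' mword_set_set.
  by move: E; rewrite vw' mword_set_in => -[_ <-]; rewrite mword_set_id.
have [vw|_] := eqVneq v; last by rewrite mulr0n mulr0.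
by move: E; rewrite vw mword_set_in => -[jl]; case: lj.
Qed.

End WTheory.

(* Main.v *)
From HB Require Import structures.
Require Import Defs.
From mathcomp Require Import all_boot all_order all_algebra.
From mathcomp Require Import ring lra zify complex.
From mathcomp Require Import all_classical all_reals all_analysis.
From mathcomp Require Import finmap.
From mathcomp Require Import -(notations) monalg.

(** Why the algebra is reflexive.

    Write [beta w] for the square root of the product of the weights of the
    components of a multiword [w]. Then W_w 1 = e_w / beta(w), so the number
    [hat x w], which is x_w / beta(w), is the inner product of x with the monomial
    of index w, and the adjoint of W_{i,j} is the translation of [hat x] by the
    letter (i, j). A vector is orthogonal to the commutator ideal exactly when
    [hat x] depends only on how often each letter occurs ([N_Qc_sym]). Such
    vectors are the power series in commuting variables; the operators L_{i,j} are
    the multiplications by the coordinates; and since the weights grow at most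
    geometrically ([weight_growth], [fock_weight_kernel]) there are reproducing
    kernels at all small points, which are total ([kernel_total]) and are common
    eigenvectors of the adjoints of the L_{i,j}.

    Let T be an operator that leaves invariant all subspaces invariant under the
    algebra. The orthogonal complement of a kernel is one of these subspaces, so
    the value of T x at z is the product of the values of x and of T 1 at z: T is
    the multiplication by the symbol T 1, and it commutes with every L_{i,j}
    ([AlgLat_commute]).

    It remains to approximate a bounded multiplication operator weakly by
    polynomials in the L_{i,j}. These are the Fejer means of the expansion of the
    symbol into homogeneous parts ([fejer]). A Fejer mean of order D is the
    average of the compressions of T to the windows of D consecutive degrees
    ([fejer_window]); as every degree lies in exactly D windows, its norm is at
    most that of T ([fejer_bound]). On vectors of finite degree the means
    converge to T by an explicit finite sum, and the uniform bound extends this to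
    all vectors ([fejer_cvg]).

    The compression to the symmetric vectors uses an orthogonal projection, which
    is provided by averaging over the finite classes of rearrangements
    ([sym_projection]). *)

Set Implicit Arguments.
Unset Strict Implicit.
Unset Printing Implicit Defensive.

Import Order.TTheory GRing.Theory Num.Theory numFieldNormedType.Exports.

Local Open Scope classical_set_scope.
Local Open Scope ring_scope.
Local Open Scope complex_scope.

(** * Norms, inner products and bounded operators *)

Lemma realC_real (R : realType) (r : R) : r%:C \is Num.real.
Proof. by rewrite realE -[0]/(0%:C) !lecR le_total. Qed.

Lemma cabsN (R : realType) (z : R[i]) : cabs (- z) = cabs z.
Proof. by apply: (@complexI R); rewrite !cabsE normrN. Qed.

Section InnerProducts.
Variables (R : realType) (H : innerProductType R).
Implicit Types x y z : H.

Definition nrm x : R := complex.Re `|x|.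

Lemma nrmE x : (nrm x)%:C = `|x|.
Proof. exact/RRe_real/normr_real. Qed.

Lemma nrm_ge0 x : 0 <= nrm x.
Proof. by rewrite -lecR nrmE; exact: normr_ge0. Qed.

Lemma inner_nrm x : inner x x = (nrm x ^+ 2)%:C.
Proof. by rewrite inner_normE -nrmE rmorphXn. Qed.

Lemma nrm0_eq0 x : nrm x = 0 -> x = 0.
Proof. by move=> x0; apply/normr0_eq0; rewrite -nrmE x0. Qed.

Lemma nrm0 : nrm (0 : H) = 0.
Proof. by apply: (@complexI R); rewrite nrmE normr0. Qed.

Lemma nrmZ c x : nrm (c *: x) = cabs c * nrm x.
Proof. by apply: (@complexI R); rewrite rmorphM/= !nrmE cabsE normrZ. Qed.

Lemma nrmD x y : nrm (x + y) <= nrm x + nrm y.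
Proof. by rewrite -lecR rmorphD/= !nrmE ler_normD. Qed.

Lemma innerC x y : inner x y = Num.conj (inner y x).
Proof. by rewrite [LHS]hermC/= expr0 mul1r. Qed.

Lemma innerDl x y z : inner (x + y) z = inner x z + inner y z.
Proof. exact: linearDl. Qed.

Lemma innerBl x y z : inner (x - y) z = inner x z - inner y z.
Proof. exact: linearBl. Qed.

Lemma innerZl c x z : inner (c *: x) z = c * inner x z.
Proof. exact: linearZl_LR. Qed.

Lemma innerDr x y z : inner x (y + z) = inner x y + inner x z.
Proof. exact: linearDr. Qed.

Lemma innerBr x y z : inner x (y - z) = inner x y - inner x z.
Proof. exact: linearBr. Qed.

Lemma innerZr c x z : inner x (c *: z) = Num.conj c * inner x z.
Proof. exact: linearZr_LR. Qed.

Lemma inner0l x : inner 0 x = 0. Proof. exact: linear0l. Qed.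

Lemma inner0r x : inner x 0 = 0. Proof. exact: linear0r. Qed.

Lemma inner_suml I (r : seq I) (P : pred I) (F : I -> H) z :
  inner (\sum_(i <- r | P i) F i) z = \sum_(i <- r | P i) inner (F i) z.
Proof. exact: linear_sumlz. Qed.

Lemma inner_self_eq0 x : inner x x = 0 -> x = 0.
Proof.
rewrite inner_nrm => /(@complexI R _ 0)/eqP.
by rewrite sqrf_eq0 => /eqP/nrm0_eq0.
Qed.

Lemma nrm_sqrB x y :
  nrm (x - y) ^+ 2 = nrm x ^+ 2 - 2 * complex.Re (inner x y) + nrm y ^+ 2.
Proof.
apply: (@complexI R); rewrite -inner_nrm innerBl !innerBr [inner y x]innerC.
rewrite !inner_nrm.
by case: (inner x y) => u v; apply/eqP; rewrite eq_complex /=; apply/andP; split; apply/eqP; ring.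
Qed.

(** The Cauchy-Schwarz inequality, from the nonnegativity of the squared norm of x
    minus its component along y. *)
Lemma cabs_inner x y : cabs (inner x y) <= nrm x * nrm y.
Proof.
have [->|y0] := eqVneq y 0; first by rewrite inner0r cabs0 mulr_ge0 ?nrm_ge0.
have ny : 0 < nrm y by rewrite lt_def nrm_ge0 andbT; apply: contra_neq y0 => /nrm0_eq0.
pose t := inner x y / ((nrm y) ^+ 2)%:C.
have := nrm_ge0 (x - t *: y); have := sqr_ge0 (nrm (x - t *: y)).
have ty : inner x (t *: y) = (cabs (inner x y) ^+ 2 / nrm y ^+ 2)%:C.
  rewrite innerZr /t rmorphM/= mulrC mulrA fmorphV/=.
  rewrite -normCK -cabsE -rmorphXn/=.
  have -> : Num.conj (nrm y ^+ 2)%:C = (nrm y ^+ 2)%:C.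
    exact/CrealP/realC_real.
  by rewrite -fmorphV -rmorphM.
rewrite nrm_sqrB ty /= nrmZ exprMn.
have -> : cabs t ^+ 2 = cabs (inner x y) ^+ 2 / nrm y ^+ 4.
  rewrite /t cabsM -fmorphV cabsR ger0_norm ?invr_ge0 ?sqr_ge0//.
  by rewrite exprMn exprVn -exprM.
have -> : cabs (inner x y) ^+ 2 / nrm y ^+ 4 * nrm y ^+ 2 =
   cabs (inner x y) ^+ 2 / nrm y ^+ 2 by field; rewrite gt_eqF.
move=> h _; rewrite -(@ler_pXn2r _ 2)// ?nnegrE ?mulr_ge0 ?nrm_ge0 ?cabs_ge0//.
rewrite exprMn -ler_pdivrMr ?exprn_gt0//.
by rewrite mulr2n mulrDl mul1r in h; lra.
Qed.

Lemma bounded_op_nrm (T : H -> H) : linear T ->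
  (exists C, forall x, nrm (T x) <= C * nrm x) -> bounded_op T.
Proof.
move=> lT [C TC]; split=> //.
pose T' : {linear H -> H} := HB.pack T (GRing.isLinear.Build _ _ _ _ T lT).
apply: (@bounded_linear_continuous _ _ _ T'); apply/linear_boundedP.
exists C%:C; split; first exact/realC_real.
move=> r Cr x; apply: (le_trans _ (ler_wpM2r (normr_ge0 x) (ltW Cr))).
by rewrite -!nrmE -rmorphM/= lecR.
Qed.

Lemma bounded_op_bound (T : H -> H) : bounded_op T ->
  exists2 C, 0 <= C & forall x, nrm (T x) <= C * nrm x.
Proof.
move=> [lT cT].
pose T' : {linear H -> H} := HB.pack T (GRing.isLinear.Build _ _ _ _ T lT).
have /linear_boundedP/pinfty_ex_gt0[r r0 h] :=
  @continuous_linear_bounded _ _ _ 0 T' (cT 0).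
exists (complex.Re r); first by move: r0; rewrite ltcE => /andP[_ /ltW].
move=> x; rewrite -lecR rmorphM/= !nrmE RRe_real; first exact: h.
exact: gtr0_real.
Qed.

Lemma inner_continuous z : continuous (fun x => inner x z : R[i]^o).
Proof.
have li : linear (fun x => inner x z : R[i]^o).
  by move=> c x y; rewrite innerDl innerZl.
pose f : {linear H -> R[i]^o} := HB.pack (fun x => inner x z : R[i]^o)
  (GRing.isLinear.Build _ _ _ _ (fun x => inner x z : R[i]^o) li).
apply: (@bounded_linear_continuous _ _ _ f); apply/linear_boundedP.
exists (nrm z)%:C; split; first exact/realC_real.
move=> r Cr x; apply: (le_trans _ (ler_wpM2r (normr_ge0 x) (ltW Cr))).
by rewrite -nrmE -rmorphM/= -cabsE lecR mulrC; exact: cabs_inner.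
Qed.

Lemma closed_subspace_inner (z : H) : closed_subspace [set x | inner x z = 0].
Proof.
split.
  split=> [|c x y /= x0 y0]; first exact: inner0l.
  by rewrite innerDl innerZl x0 y0 mulr0 addr0.
have -> : [set x | inner x z = 0] = (fun x => inner x z : R[i]^o) @^-1` [set 0].
  by [].
apply: closed_comp; last first.
  exact: accessible_closed_set1 (hausdorff_accessible (@norm_hausdorff _ _)) 0.
by move=> x _; exact: inner_continuous.
Qed.

End InnerProducts.

(** * Coordinates in Hilbert sequence spaces *)

Section SumsReindex.
Variable R : realType.

Lemma esum_push (I J : choiceType) (s : J -> I) (f : I -> \bar R) :
  injective s -> (forall i, f i != 0%E -> range s i) ->
  (\esum_(i in setT) f i = \esum_(j in setT) f (s j))%E.
Proof.
move=> si f0; rewrite -(@esum_image R J I setT s f); last by move=> ? ? _ _ /si.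
rewrite [RHS]esum_mkcond; apply: eq_esum => i _.
case: ifPn => // ni; apply/eqP; apply: contraNT ni => fi.
exact/mem_set/f0.
Qed.

Lemma csum_push (I J : choiceType) (s : J -> I) (u : I -> R[i]) :
  injective s -> (forall i, u i != 0 -> range s i) ->
  csum u = csum (u \o s).
Proof.
move=> si u0; have nz (g : R[i] -> \bar R) (g0 : g 0 = 0%E) :
    (\esum_(i in setT) g (u i) = \esum_(j in setT) g (u (s j)))%E.
  apply: (esum_push (f := fun i => g (u i)) si) => i gi; apply: u0.
  by apply: contra_neq gi => ->.
rewrite /csum /rsum; congr ((fine _ - fine _) +i* (fine _ - fine _)).
- rewrite (eq_esum (fun i _ => funeposE _ i)) (eq_esum (fun j _ => funeposE _ j)).
  by apply: (nz (fun z => maxe (complex.Re z)%:E 0%E)); rewrite maxxx.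
- rewrite (eq_esum (fun i _ => funenegE _ i)) (eq_esum (fun j _ => funenegE _ j)).
  by apply: (nz (fun z => maxe (- (complex.Re z)%:E)%E 0%E)); rewrite oppe0 maxxx.
- rewrite (eq_esum (fun i _ => funeposE _ i)) (eq_esum (fun j _ => funeposE _ j)).
  by apply: (nz (fun z => maxe (complex.Im z)%:E 0%E)); rewrite maxxx.
- rewrite (eq_esum (fun i _ => funenegE _ i)) (eq_esum (fun j _ => funenegE _ j)).
  by apply: (nz (fun z => maxe (- (complex.Im z)%:E)%E 0%E)); rewrite oppe0 maxxx.
Qed.

Lemma csum_point (I : choiceType) (u : I -> R[i]) i :
  (forall j, j != i -> u j = 0) -> csum u = u i.
Proof.
move=> u0; rewrite (@csum_push I unit (fun=> i)); last 2 first.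
- by move=> [] [].
- by move=> j uj; exists tt => //; apply/esym/eqP; apply: contraNT uj => /u0 ->.
have e1 (f : unit -> \bar R) : (forall t, (0 <= f t)%E) ->
    (\esum_(t in setT) f t = f tt)%E.
  move=> f0; have -> : [set: unit] = [set tt] by apply/seteqP; split => // -[].
  by rewrite esum_set1.
have e2 (f : unit -> R) : rsum f = f tt.
  rewrite /rsum !e1; [|by move=> t; rewrite funeneg_ge0|by move=> t; rewrite funepos_ge0].
  rewrite funeposE funenegE /= -!EFin_max /=.
  have [h|h] := leP 0 (f tt).
    by rewrite max_r ?oppr_le0// subr0.
  by rewrite max_l ?oppr_ge0 ?ltW// opprK add0r.
by rewrite /csum !e2 /=; case: (u i).
Qed.

End SumsReindex.

Section Ell2Norm.
Variable R : realType.

Lemma ell2_ext (I : choiceType) (x y : ell2 R I) : (forall i, x i = y i) -> x = y.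
Proof. by move=> xy; apply/val_inj/funext. Qed.

Lemma ell2_sumE (I : choiceType) (K : Type) (r : seq K) (F : K -> ell2 R I) i :
  (\sum_(l <- r) F l) i = \sum_(l <- r) F l i.
Proof.
elim: r => [|l r IH]; first by rewrite !big_nil.
by rewrite !big_cons ell2D IH.
Qed.

Lemma ell2B (I : choiceType) (x y : ell2 R I) i : (x - y) i = x i - y i.
Proof. by []. Qed.

Lemma inner_ell2E (I : choiceType) (x y : ell2 R I) :
  inner x y = csum (fun i => x i * Num.conj (y i)).
Proof. by []. Qed.

Lemma inner_basisr (I : choiceType) (x : ell2 R I) i : inner x (ell2_basis R i) = x i.
Proof.
rewrite inner_ell2E (csum_point (i := i)) => [|j ji].
  by rewrite ell2_basisE eqxx rmorph1 mulr1.
by rewrite ell2_basisE (negPf ji) rmorph0 mulr0.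
Qed.

Lemma inner_basisl (I : choiceType) (y : ell2 R I) i :
  inner (ell2_basis R i) y = Num.conj (y i).
Proof. by rewrite innerC inner_basisr. Qed.

Lemma nrm_sqrE (I : choiceType) (x : ell2 R I) :
  (nrm x ^+ 2)%:E = (\esum_(i in setT) (cabs (x i) ^+ 2)%:E)%E.
Proof.
have fn : (\esum_(i in setT) (cabs (x i) ^+ 2)%:E \is a fin_num)%E.
  have := ell2P x; rewrite /square_summable summableE.
  congr (is_true (_ \is a fin_num)); apply: eq_esum => i _.
  by rewrite gee0_abs// lee_fin sqr_ge0.
rewrite -[RHS]fineK//; congr (_%:E).
have := congr1 (@complex.Re R) (inner_nrm x); rewrite /= => <-.
rewrite /rsum.
have -> : (fun i => complex.Re (x i * Num.conj (x i))) = fun i => cabs (x i) ^+ 2.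
  by apply/funext => i; rewrite -normCK -cabsE -rmorphXn.
rewrite [X in _ - fine X]esum1 ?subr0 => [|i _]; last first.
  by rewrite funenegE /= max_r// lee_fin oppr_le0 sqr_ge0.
congr fine; apply: eq_esum => i _.
by rewrite funeposE /= max_l// lee_fin sqr_ge0.
Qed.

Lemma sum_le_nrm (I : choiceType) (x : ell2 R I) (r : seq I) : uniq r ->
  \sum_(i <- r) cabs (x i) ^+ 2 <= nrm x ^+ 2.
Proof.
move=> ur; rewrite -lee_fin nrm_sqrE; apply: esum_ge; exists [set` r].
  by split.
by rewrite -fsbig_seq//= sumEFin.
Qed.

Lemma esum_sup_seq (I : choiceType) (f : I -> R) (M : R) :
  (forall i, 0 <= f i) ->
  (forall r : seq I, uniq r -> \sum_(i <- r) f i <= M) ->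
  (\esum_(i in setT) (f i)%:E <= M%:E)%E.
Proof.
move=> f0 rM; apply: ge_ereal_sup => _ [A [fA _] <-].
rewrite fsbig_finite//= sumEFin lee_fin; apply: rM.
exact: fset_uniq.
Qed.

Lemma square_summable_bound (I : choiceType) (x : I -> R[i]) (M : R) :
  (forall r : seq I, uniq r -> \sum_(i <- r) cabs (x i) ^+ 2 <= M) ->
  square_summable x.
Proof.
move=> rM; rewrite /square_summable /summable.
apply: (@le_lt_trans _ _ M%:E); last exact: ltry.
rewrite (eq_esum (b := fun i => (cabs (x i) ^+ 2)%:E)); last first.
  by move=> i _; rewrite gee0_abs// lee_fin sqr_ge0.
by apply: esum_sup_seq => // i; exact: sqr_ge0.
Qed.

Lemma nrm_le_bound (I : choiceType) (x : ell2 R I) (M : R) : 0 <= M ->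
  (forall r : seq I, uniq r -> \sum_(i <- r) cabs (x i) ^+ 2 <= M ^+ 2) -> nrm x <= M.
Proof.
move=> M0 h; rewrite -(@ler_pXn2r _ 2)// ?nnegrE ?nrm_ge0//.
rewrite -lee_fin nrm_sqrE; apply: esum_sup_seq => // i; exact: sqr_ge0.
Qed.

Lemma nrm_approx (I : choiceType) (x : ell2 R I) (e : R) : 0 < e ->
  exists2 r : seq I, uniq r & nrm x ^+ 2 - e < \sum_(i <- r) cabs (x i) ^+ 2.
Proof.
move=> e0; apply: contrapT => nex.
suff : nrm x ^+ 2 <= nrm x ^+ 2 - e by lra.
rewrite -lee_fin nrm_sqrE; apply: esum_sup_seq => [i|r ur]; first exact: sqr_ge0.
by rewrite leNgt; apply/negP => h; apply: nex; exists r.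
Qed.

(** One estimate for three kinds of operators on coordinates: restrictions,
    multiplications by bounded families and pullbacks along injections. *)
Lemma nrm_le_reindex (I J : choiceType) (s : J -> I) c (x : ell2 R J) (y : ell2 R I) :
  injective s -> 0 <= c -> (forall j, cabs (x j) <= c * cabs (y (s j))) ->
  nrm x <= c * nrm y.
Proof.
move=> si c0 xy; apply: nrm_le_bound => [|r ur]; first by rewrite mulr_ge0 ?nrm_ge0.
apply: (@le_trans _ _ (\sum_(j <- r) c ^+ 2 * cabs (y (s j)) ^+ 2)).
  apply: ler_sum => j _; rewrite -exprMn lerXn2r ?nnegrE ?cabs_ge0//.
  by rewrite mulr_ge0 ?cabs_ge0.
rewrite -mulr_sumr exprMn ler_wpM2l ?sqr_ge0//.
rewrite -(big_map s xpredT (fun i => cabs (y i) ^+ 2)); apply: sum_le_nrm.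
by rewrite map_inj_uniq.
Qed.

End Ell2Norm.

Section Restriction.
Variables (R : realType) (I : choiceType).
Implicit Types (x y : ell2 R I) (P Q : pred I).

Fact restr_key : unit. Proof. by []. Qed.
(** Locked, like the other operators given by coordinates below: unification
    would otherwise compare the coordinate functions. *)
Definition restr P x : ell2 R I :=
  locked_with restr_key (to_ell2 (fun i => if P i then x i else 0)).

Lemma restrE P x i : restr P x i = if P i then x i else 0.
Proof.
rewrite /restr unlock to_ell2E//; apply: (square_summable_le (c := 1)) (ell2P x) => {}i.
by rewrite mul1r; case: ifP => // _; rewrite cabs0 cabs_ge0.
Qed.

Lemma inner_restr P x y : inner (restr P x) y = inner x (restr P y).
Proof.
rewrite !inner_ell2E; congr csum; apply/funext => i; rewrite !restrE.
by case: ifP => // _; rewrite rmorph0 mul0r mulr0.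
Qed.

Lemma restr_restr P Q x : restr P (restr Q x) = restr (predI P Q) x.
Proof. by apply: ell2_ext => i; rewrite !restrE /=; case: (P i); case: (Q i). Qed.

Lemma restrC P x : x - restr P x = restr (predC P) x.
Proof.
apply: ell2_ext => i; rewrite ell2B !restrE /=.
by case: (P i); rewrite ?subrr ?subr0.
Qed.

Lemma nrm_restr P x : nrm (restr P x) <= nrm x.
Proof.
rewrite -[leRHS]mul1r; apply: (nrm_le_reindex (s := id)) => // i.
by rewrite restrE mul1r; case: ifP => // _; rewrite cabs0 cabs_ge0.
Qed.

Lemma restr_sum P (r : seq I) x : uniq r -> (forall i, (i \in r) = P i) ->
  restr P x = \sum_(i <- r) x i *: ell2_basis R i.
Proof.
move=> ur rP; apply: ell2_ext => i; rewrite restrE ell2_sumE -rP.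
under eq_bigr do rewrite ell2Z ell2_basisE.
case: ifPn => [ir|ir].
  rewrite (bigD1_seq i)//= eqxx mulr1 big1 ?addr0// => j ji.
  by rewrite eq_sym (negPf ji) mulr0.
rewrite big_seq big1// => j jr; case: eqP => [ij|]; last by rewrite mulr0.
by rewrite ij jr in ir.
Qed.

Lemma inner_restr_sum P (r : seq I) x y : uniq r -> (forall i, (i \in r) = P i) ->
  inner (restr P x) y = \sum_(i <- r) x i * Num.conj (y i).
Proof.
move=> ur rP; rewrite (restr_sum _ ur rP) inner_suml.
by apply: eq_bigr => i _; rewrite innerZl inner_basisl.
Qed.

Lemma nrm_restr_sum P (r : seq I) x : uniq r -> (forall i, (i \in r) = P i) ->
  nrm (restr P x) ^+ 2 = \sum_(i <- r) cabs (x i) ^+ 2.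
Proof.
move=> ur rP; apply: (@complexI R).
rewrite -inner_nrm -inner_restr restr_restr rmorph_sum/=.
rewrite (inner_restr_sum _ _ ur) => [|i]; last by rewrite /= andbb.
by apply: eq_bigr => i _; rewrite -normCK -cabsE -rmorphXn.
Qed.

Lemma nrm_restrC P x : nrm (restr (predC P) x) ^+ 2 = nrm x ^+ 2 - nrm (restr P x) ^+ 2.
Proof.
rewrite -restrC nrm_sqrB.
have -> : inner x (restr P x) = (nrm (restr P x) ^+ 2)%:C.
  rewrite -inner_nrm inner_restr restr_restr.
  by congr (inner _ _); apply: ell2_ext => i; rewrite !restrE /= andbb.
by rewrite /=; ring.
Qed.

End Restriction.

(** * Words up to rearrangement *)

Section Words.
Variables (k : nat) (n : 'I_k -> nat).
Implicit Types (w u v : mword n).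

Definition letter := {i : 'I_k & 'I_(n i)}.

Definition lmul (l : letter) w : mword n := mword_set w (tagged l :: w (tag l)).

Definition cnt (l : letter) w : nat := count_mem (tagged l) (w (tag l)).

Definition deg w : nat := (\sum_(l : letter) cnt l w)%N.

(** Equal letter counts mean that each component of w is a rearrangement of the
    corresponding component of v. *)
Definition permw w v : bool := [forall l : letter, cnt l w == cnt l v].

Local Notation one := (mword_one n).

Lemma cnt_one l : cnt l one = 0%N.
Proof. by rewrite /cnt ffunE. Qed.

Lemma cnt_lmul l l' w : cnt l (lmul l' w) = ((l' == l) + cnt l w)%N.
Proof.
case: l l' => i j [i' j']; rewrite /cnt /lmul /=.
have [ii'|ii'] := eqVneq i' i.
  by subst i'; rewrite mword_set_in /= eq_Tagged.
rewrite mword_set_out//; case: eqP => // e.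
by move/(congr1 tag): e ii' => /= ->; rewrite eqxx.
Qed.

Lemma cnt_mul l u v : cnt l (mword_mul u v) = (cnt l u + cnt l v)%N.
Proof. by rewrite /cnt ffunE count_cat. Qed.

Lemma deg_lmul l w : deg (lmul l w) = (deg w).+1.
Proof.
rewrite /deg; under eq_bigr do rewrite cnt_lmul.
rewrite big_split/= (bigD1 l)//= eqxx big1 => [|l' l'l]; first by rewrite addn0.
by rewrite eq_sym (negPf l'l).
Qed.

Lemma deg_one : deg one = 0%N.
Proof. by rewrite /deg big1// => l _; rewrite cnt_one. Qed.

Lemma deg_mul u v : deg (mword_mul u v) = (deg u + deg v)%N.
Proof. by rewrite -big_split; apply: eq_bigr => l _; rewrite cnt_mul. Qed.

Lemma lmul_inj l : injective (lmul l).
Proof.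
case: l => i j u v uv; apply/ffunP => i'.
have := congr1 (fun w : mword n => w i') uv; rewrite /lmul /=.
have [ii'|ii'] := eqVneq i i'; last by rewrite !mword_set_out.
by subst i'; rewrite !mword_set_in => -[].
Qed.

Lemma lmul_lift (i : 'I_k) (j : 'I_(n i)) alpha w :
  w i = j :: alpha -> w = lmul (Tagged _ j) (mword_set w alpha).
Proof.
by move=> wi; rewrite /lmul /= mword_set_in mword_set_set -wi mword_set_id.
Qed.

Lemma mword_case w : w = one \/ exists l v, w = lmul l v.
Proof.
have [w1|w1] := pselect (forall i, w i = [::]).
  by left; apply/ffunP => i; rewrite w1 ffunE.
right; have [i wi] : exists i, w i <> [::] by apply: contrapT => h; apply/w1 => i;
  apply: contrapT => wi; apply: h; exists i.
case E : (w i) wi => [//|j alpha] _.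
by exists (Tagged (fun i => 'I_(n i)) j), (mword_set w alpha); exact: lmul_lift.
Qed.

Lemma mword_ind (P : mword n -> Prop) : P one ->
  (forall l w, P w -> P (lmul l w)) -> forall w, P w.
Proof.
move=> P1 PM w; have [d] := ubnP (deg w); elim: d w => // d IH w.
case: (mword_case w) => [->//|[l [v ->]]]; rewrite deg_lmul ltnS => dv.
exact/PM/IH.
Qed.

Lemma mul1w u : mword_mul one u = u.
Proof. by apply/ffunP => i; rewrite !ffunE. Qed.

Lemma mulw1 u : mword_mul u one = u.
Proof. by apply/ffunP => i; rewrite !ffunE cats0. Qed.

Lemma mword_mulA u v w : mword_mul u (mword_mul v w) = mword_mul (mword_mul u v) w.
Proof. by apply/ffunP => i; rewrite !ffunE catA. Qed.

Lemma lmul_mul l u v : mword_mul (lmul l u) v = lmul l (mword_mul u v).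
Proof.
case: l => i j; apply/ffunP => i'; rewrite /lmul /= ffunE.
have [ii'|ii'] := eqVneq i i'; last by rewrite !mword_set_out// ffunE.
by subst i'; rewrite !mword_set_in ffunE.
Qed.

Lemma lmulC (l l' : letter) w : tag l != tag l' -> lmul l (lmul l' w) = lmul l' (lmul l w).
Proof.
case: l l' => i j [i' j'] /= ii'; apply/ffunP => i0; rewrite /lmul /=.
have i'i : i' != i by rewrite eq_sym.
have [e|ii0] := eqVneq i i0.
  subst i0; rewrite mword_set_in [RHS]mword_set_out// mword_set_in.
  by rewrite mword_set_out.
have [e|i'i0] := eqVneq i' i0.
  by subst i0; rewrite mword_set_in [LHS]mword_set_out// mword_set_in mword_set_out.
by rewrite !mword_set_out.
Qed.

Lemma deg_sizes w : deg w = (\sum_(i < k) size (w i))%N.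
Proof.
elim/mword_ind: w => [|l w IH].
  by rewrite deg_one big1// => i _; rewrite ffunE.
rewrite deg_lmul IH [RHS](bigD1 (tag l))//= [in LHS](bigD1 (tag l))//=.
rewrite /lmul mword_set_in addSn; congr (_ + _).+1.
by apply: eq_bigr => i il; rewrite mword_set_out// eq_sym.
Qed.

Lemma permw_refl w : permw w w. Proof. exact/forallP. Qed.

Lemma permwP w v : reflect (forall l, cnt l w = cnt l v) (permw w v).
Proof. by apply: (iffP forallP) => h l; apply/eqP; rewrite h. Qed.

Lemma permw_sym w v : permw w v = permw v w.
Proof. by apply/permwP/permwP => h l; rewrite h. Qed.

Lemma permw_trans w u v : permw w u -> permw u v -> permw w v.
Proof. by move=> /permwP wu /permwP uv; apply/permwP => l; rewrite wu. Qed.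

Lemma permw_deg w v : permw w v -> deg w = deg v.
Proof. by move=> /permwP wv; apply: eq_bigr. Qed.

Lemma permw_mulC u v : permw (mword_mul u v) (mword_mul v u).
Proof. by apply/permwP => l; rewrite !cnt_mul addnC. Qed.

Lemma permw_lmul l u v : permw (lmul l u) (lmul l v) = permw u v.
Proof. by apply/permwP/permwP => h l'; have := h l'; rewrite !cnt_lmul; [move/addnI|move->]. Qed.

Lemma permw_mul2l u v v' : permw v v' -> permw (mword_mul u v) (mword_mul u v').
Proof. by move=> /permwP h; apply/permwP => l; rewrite !cnt_mul h. Qed.

Definition swap_invariant T (f : mword n -> T) := forall u l1 l2 v,
  f (mword_mul u (lmul l1 (lmul l2 v))) = f (mword_mul u (lmul l2 (lmul l1 v))).

Lemma swap_invariant_lmul T (f : mword n -> T) l :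
  swap_invariant f -> swap_invariant (f \o lmul l).
Proof. by move=> sf u l1 l2 v /=; rewrite -!lmul_mul sf. Qed.

Lemma swap_to_front l w : (0 < cnt l w)%N -> exists2 v, permw w (lmul l v) &
  forall T (f : mword n -> T), swap_invariant f -> f w = f (lmul l v).
Proof.
elim/mword_ind: w => [|l' w IH]; first by rewrite cnt_one.
rewrite cnt_lmul; have [->|ll'] := eqVneq l' l.
  by move=> _; exists w => //; exact: permw_refl.
move=> /IH[v wv fv]; exists (lmul l' v).
  apply: (@permw_trans _ (lmul l' (lmul l v))); first by rewrite permw_lmul.
  by apply/permwP => l0; rewrite !cnt_lmul addnCA.
move=> T f sf; have := fv _ _ (swap_invariant_lmul l' sf) => /= ->.
by have := sf one l' l v; rewrite !mul1w.
Qed.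

(** Adjacent transpositions generate all rearrangements: bring the first letter
    of one word to the front of the other, then recurse. *)
Lemma swap_invariant_permw T (f : mword n -> T) w v :
  swap_invariant f -> permw w v -> f w = f v.
Proof.
elim/mword_ind: w f v => [|l w IH] f v sf.
  move=> /permw_deg; rewrite deg_one; case: (mword_case v) => [->//|[l [u ->]]].
  by rewrite deg_lmul.
move=> wv; have : (0 < cnt l v)%N by move/permwP: wv => <-; rewrite cnt_lmul eqxx.
move=> /swap_to_front[u vu fu]; rewrite (fu _ _ sf).
apply: (IH (f \o lmul l)); first exact: swap_invariant_lmul.
by rewrite -(permw_lmul l); exact: permw_trans vu.
Qed.

Fixpoint level d : seq (mword n) :=
  if d is d'.+1 then undup [seq lmul l w | l <- enum {: letter}, w <- level d']
  else [:: one].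

Lemma level_uniq d : uniq (level d).
Proof. by case: d => //= d; rewrite undup_uniq. Qed.

Lemma mem_level d w : (w \in level d) = (deg w == d).
Proof.
elim: d w => [|d IH] w /=.
  rewrite inE; apply/eqP/eqP => [->|]; first exact: deg_one.
  by case: (mword_case w) => [->//|[l [v ->]]]; rewrite deg_lmul.
rewrite mem_undup; apply/allpairsP/eqP => [[[l v] /= [_ vd ->]]|].
  by rewrite deg_lmul; congr _.+1; apply/eqP; rewrite -IH.
case: (mword_case w) => [->|[l [v ->]]]; first by rewrite deg_one.
rewrite deg_lmul => -[dv]; exists (l, v) => /=; split => //.
  by rewrite mem_enum.
by rewrite IH dv.
Qed.

Lemma size_level d : (size (level d) <= #|{: letter}| ^ d)%N.
Proof.
elim: d => //= d IH; apply: (leq_trans (size_undup _)).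
by rewrite size_allpairs -cardE expnS leq_mul2l IH orbT.
Qed.

Fixpoint box D : seq (mword n) :=
  if D is D'.+1 then box D' ++ level D' else [::].

Lemma mem_box D w : (w \in box D) = (deg w < D)%N.
Proof.
by elim: D => //= D IH; rewrite mem_cat IH mem_level ltnS [in RHS]leq_eqVlt orbC.
Qed.

Lemma box_uniq D : uniq (box D).
Proof.
elim: D => //= D IH; rewrite cat_uniq IH level_uniq andbT /=.
by apply/hasPn => w; rewrite mem_level mem_box => /eqP ->; rewrite ltnn.
Qed.

Lemma sub_box (r : seq (mword n)) : exists D, {subset r <= box D}.
Proof.
exists (\max_(w <- r) deg w).+1 => w wr; rewrite mem_box ltnS.
exact: leq_bigmax_seq.
Qed.

Lemma big_box_le (V : nmodType) D G (F : mword n -> V) : (D <= G)%N ->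
  (forall u, (D <= deg u)%N -> F u = 0%R) ->
  (\sum_(u <- box G) F u = \sum_(u <- box D) F u)%R.
Proof.
move=> DG F0; elim: G DG => [|G IH]; first by rewrite leqn0 => /eqP ->.
rewrite leq_eqVlt => /orP[/eqP -> //|DG].
rewrite /= big_cat/= IH// [X in (_ + X)%R]big_seq [X in (_ + X)%R]big1 ?addr0// => u.
by rewrite mem_level => /eqP uG; apply: F0; rewrite uG.
Qed.

(** Rearrangements preserve the degree, so the class of w lies in a finite box. *)
Definition cls w : seq (mword n) := [seq v <- box (deg w).+1 | permw w v].

Lemma mem_cls w v : (v \in cls w) = permw w v.
Proof.
rewrite mem_filter mem_box; case: (boolP (permw w v)) => //= /permw_deg ->.
exact: ltnSn.
Qed.

Lemma cls_uniq w : uniq (cls w).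
Proof. exact/filter_uniq/box_uniq. Qed.

End Words.

Section WordSums.
Variables (R : realType) (k : nat) (n : 'I_k -> nat).
Implicit Types (w u v : mword n).

Lemma ler_sum_subset (I : eqType) (r s : seq I) (F : I -> R) :
  uniq r -> uniq s -> {subset r <= s} -> (forall i, 0 <= F i) ->
  \sum_(i <- r) F i <= \sum_(i <- s) F i.
Proof.
move=> ur us rs F0; rewrite [leRHS](bigID (mem r))/=.
rewrite -[X in _ <= X + _]big_filter.
suff /(perm_big r) -> : perm_eq [seq i <- s | i \in r] r by rewrite lerDl sumr_ge0.
apply: uniq_perm => //; first exact: filter_uniq.
move=> i; rewrite mem_filter; case: (boolP (i \in r)) => //= /rs.
by move=> ->.
Qed.

(** With N letters there are at most N ^ d words of degree d, so the sum is
    dominated by the geometric series of ratio 1/2. *)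
Lemma sum_geo_words (q : R) (r : seq (mword n)) :
  0 <= q -> #|{: letter n}|%:R * q <= 2^-1 -> uniq r ->
  \sum_(w <- r) q ^+ deg w <= 2.
Proof.
move=> q0 hq ur; have [D rD] := sub_box r.
apply: le_trans (ler_sum_subset ur (box_uniq n D) rD _) _.
  by move=> w; exact: exprn_ge0.
have lev d : \sum_(w <- level n d) q ^+ deg w <= 2^-1 ^+ d.
  apply: (@le_trans _ _ ((#|{: letter n}|%:R * q) ^+ d)); last first.
    by rewrite lerXn2r ?nnegrE ?mulr_ge0.
  rewrite (eq_big_seq (fun=> q ^+ d)) => [|w]; last first.
    by rewrite mem_level => /eqP ->.
  rewrite big_const_seq count_predT iter_addr_0 exprMn -natrX.
  by rewrite -[leLHS]mulr_natl ler_wpM2r ?exprn_ge0// ler_nat size_level.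
suff : \sum_(w <- box n D) q ^+ deg w <= 2 - 2 * 2^-1 ^+ D.
  by move/le_trans; apply; rewrite gerBl mulr_ge0// exprn_ge0.
elim: D {rD} => [|D IH] /=; first by rewrite big_nil expr0 mulr1 subrr.
rewrite big_cat/= exprS; have := lev D; lra.
Qed.

Definition zmon (z : letter n -> R) w : R := \prod_(l : letter n) z l ^+ cnt l w.

Lemma zmon_ge0 z w : (forall l, 0 <= z l) -> 0 <= zmon z w.
Proof. by move=> z0; apply: prodr_ge0 => l _; rewrite exprn_ge0. Qed.

Lemma zmon_one z : zmon z (mword_one n) = 1.
Proof. by rewrite /zmon big1// => l _; rewrite cnt_one. Qed.

Lemma zmon_lmul z l w : zmon z (lmul l w) = z l * zmon z w.
Proof.
rewrite /zmon; under eq_bigr do rewrite cnt_lmul exprD.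
rewrite big_split/=; congr (_ * _); rewrite (bigD1 l)//= eqxx big1 ?mulr1//.
by move=> l' l'l; rewrite eq_sym (negPf l'l).
Qed.

Lemma zmon_permw z w v : permw w v -> zmon z w = zmon z v.
Proof. by move=> /permwP wv; apply: eq_bigr => l _; rewrite wv. Qed.

Lemma zmon_le z e w : (forall l, 0 <= z l <= e) -> zmon z w <= e ^+ deg w.
Proof.
move=> ze; rewrite /deg -prodrXr; apply: ler_prod => l _.
have /andP[z0 zle] := ze l.
by rewrite exprn_ge0// lerXn2r// nnegrE (le_trans z0).
Qed.

Lemma zmon_scale z t l w :
  zmon (fun l' => if l' == l then t * z l' else z l') w = t ^+ cnt l w * zmon z w.
Proof.
rewrite /zmon (bigD1 l)//= eqxx exprMn -mulrA; congr (_ * _).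
rewrite [RHS](bigD1 l)//=; congr (_ * _); apply: eq_bigr => l' l'l.
by rewrite (negPf l'l).
Qed.

End WordSums.

(** * Weighted shifts and symmetric vectors *)

Section Truncation.
Variables (R : realType) (k : nat) (n : 'I_k -> nat).
Local Notation H := (ell2 R (mword n)).
Implicit Types (x y v : H) (w u : mword n).

Definition trunc D x : H := restr (fun w => (deg w < D)%N) x.

Lemma truncE D x w : trunc D x w = if (deg w < D)%N then x w else 0.
Proof. exact: restrE. Qed.

Lemma inner_trunc D x y :
  inner (trunc D x) y = \sum_(w <- box n D) x w * Num.conj (y w).
Proof. by apply: inner_restr_sum; [exact: box_uniq | exact: mem_box]. Qed.

Lemma trunc_id G x : (forall w, (G <= deg w)%N -> x w = 0) -> trunc G x = x.
Proof.
move=> x0; apply: ell2_ext => w; rewrite truncE.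
by case: ltnP => // /x0 ->.
Qed.

Lemma inner_finl G x y : (forall w, (G <= deg w)%N -> x w = 0) ->
  inner x y = \sum_(w <- box n G) x w * Num.conj (y w).
Proof. by move=> /trunc_id {1}<-; exact: inner_trunc. Qed.

Lemma inner_finr G x y : (forall w, (G <= deg w)%N -> y w = 0) ->
  inner x y = \sum_(w <- box n G) x w * Num.conj (y w).
Proof. by move=> /trunc_id {1}<-; rewrite /trunc -inner_restr; exact: inner_trunc. Qed.

Lemma trunc_approx x (e : R) : 0 < e ->
  exists D0, forall D, (D0 <= D)%N -> nrm (x - trunc D x) <= e.
Proof.
move=> e0; have [|r ur rx] := nrm_approx x (e := e ^+ 2); first exact: exprn_gt0.
have [D0 rD] := sub_box r; exists D0 => D D0D.
rewrite -(@ler_pXn2r _ 2)// ?nnegrE ?nrm_ge0 ?(ltW e0)//.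
pose P w := (deg w < D)%N.
have -> : x - trunc D x = restr (predC P) x by exact: restrC.
rewrite nrm_restrC.
have -> := nrm_restr_sum (P := P) x (box_uniq n D) (mem_box D).
suff : \sum_(i <- r) cabs (x i) ^+ 2 <= \sum_(i <- box n D) cabs (x i) ^+ 2 by lra.
apply: ler_sum_subset => //; first exact: box_uniq.
  by move=> w /rD; rewrite !mem_box => /leq_trans; apply.
by move=> w; exact: sqr_ge0.
Qed.

Lemma inner0_trunc x y : (forall D, inner x (trunc D y) = 0) -> inner x y = 0.
Proof.
move=> xy; apply/normr0_eq0; rewrite -cabsE.
suff -> : cabs (inner x y) = 0 by [].
apply/eqP; rewrite eq_le cabs_ge0 andbT; apply/ler_addgt0Pr => e e0; rewrite add0r.
have [|D /(_ D (leqnn D)) yD] := trunc_approx y (e := e / (nrm x + 1)).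
  by rewrite divr_gt0// ltr_wpDl ?nrm_ge0.
rewrite -[inner x y]subr0 -(xy D) -innerBr; apply: le_trans (cabs_inner _ _) _.
have nx := nrm_ge0 x; have nx1 : 0 < nrm x + 1 by rewrite ltr_wpDl.
apply: (@le_trans _ _ ((nrm x + 1) * (e / (nrm x + 1)))).
  by apply: ler_pM; rewrite ?nrm_ge0// lerDl.
by rewrite mulrCA mulfV ?mulr1// gt_eqF.
Qed.

End Truncation.

Section WeightedFock.
Variables (R : realType) (k : nat) (n : 'I_k -> nat) (beta : mword n -> R).
Hypothesis beta_gt0 : forall w, 0 < beta w.
Hypothesis beta_shift :
  forall l, exists2 c, 0 <= c & forall w, beta w <= c * beta (lmul l w).
Local Notation H := (ell2 R (mword n)).
Local Notation one := (mword_one n).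
Implicit Types (x y : H) (w u v : mword n) (l : letter n).

Let beta_neq0 w : (beta w)%:C != 0.
Proof. by rewrite -[0]/(0%:C) (inj_eq (@complexI R)) gt_eqF. Qed.

(** The inner product of x with the monomial e_w / beta(w). The weighted shifts send
    monomials to monomials, so their adjoints act on [hat x] by translation. *)
Definition hat x w : R[i] := x w / (beta w)%:C.

Lemma hatK x w : (beta w)%:C * hat x w = x w.
Proof. by rewrite /hat mulrCA mulfV ?mulr1. Qed.

(** The vectors whose pairings with monomials ignore the order of the letters. *)
Definition sym x : Prop := forall w v, permw w v -> hat x w = hat x v.

Lemma hat_ext x y : (forall w, hat x w = hat y w) -> x = y.
Proof. by move=> xy; apply: ell2_ext => w; rewrite -hatK xy hatK. Qed.

Fact bshift_key : unit. Proof. by []. Qed.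
(** The adjoint of the weighted shift by the letter l. *)
Definition bshift l x : H := locked_with bshift_key
  (to_ell2 (fun w => (beta w / beta (lmul l w))%:C * x (lmul l w))).

Lemma bshiftE l x w : bshift l x w = (beta w / beta (lmul l w))%:C * x (lmul l w).
Proof.
rewrite /bshift unlock to_ell2E//; have [c c0 bc] := beta_shift l.
apply: (@square_summable_le _ _ c _ (x \o lmul l)) => [v|].
  rewrite cabsM ler_wpM2r ?cabs_ge0// cabsR ger0_norm ?divr_ge0 ?(ltW (beta_gt0 _))//.
  by rewrite ler_pdivrMr.
exact: square_summable_comp (@lmul_inj _ _ l) (ell2P x).
Qed.

Lemma nrm_bshift l : exists2 c, 0 <= c & forall x, nrm (bshift l x) <= c * nrm x.
Proof.
have [c c0 bc] := beta_shift l; exists c => // x.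
apply: nrm_le_reindex (@lmul_inj _ _ l) c0 _ => w; rewrite bshiftE.
rewrite cabsM ler_wpM2r ?cabs_ge0// cabsR ger0_norm ?divr_ge0 ?(ltW (beta_gt0 _))//.
by rewrite ler_pdivrMr.
Qed.

Lemma hat_bshift l x w : hat (bshift l x) w = hat x (lmul l w).
Proof.
rewrite /hat bshiftE rmorphM fmorphV/=.
by field; rewrite !beta_neq0.
Qed.

Lemma sym_bshift l x : sym x -> sym (bshift l x).
Proof. by move=> sx w v wv; rewrite !hat_bshift; apply: sx; rewrite permw_lmul. Qed.

Fact bshift_word_key : unit. Proof. by []. Qed.
(** The adjoint of the product of the weighted shifts along u. *)
Definition bshift_word u x : H := locked_with bshift_word_key
  (to_ell2 (fun w => (beta w)%:C * hat x (mword_mul u w))).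

Lemma hat_bshift_word u x w : hat (bshift_word u x) w = hat x (mword_mul u w).
Proof.
rewrite /bshift_word unlock {1}/hat to_ell2E; first by rewrite mulrAC mulfV ?mul1r.
elim/mword_ind: u x {w} => [|l u IH] x.
  have -> : (fun w => (beta w)%:C * hat x (mword_mul one w)) = x.
    by apply/funext => w; rewrite mul1w hatK.
  exact: ell2P.
have := IH (bshift l x); congr square_summable; apply/funext => w.
by rewrite hat_bshift lmul_mul.
Qed.

Lemma bshift_word_one x : bshift_word one x = x.
Proof. by apply: hat_ext => w; rewrite hat_bshift_word mul1w. Qed.

Lemma bshift_word_lmul l u x : bshift_word (lmul l u) x = bshift_word u (bshift l x).
Proof. by apply: hat_ext => w; rewrite !hat_bshift_word hat_bshift lmul_mul. Qed.

Lemma bshift_wordE u x w :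
  bshift_word u x w = (beta w)%:C * hat x (mword_mul u w).
Proof. by rewrite -hat_bshift_word hatK. Qed.

Lemma sym_bshift_word u x : sym x -> sym (bshift_word u x).
Proof. by move=> sx w v wv; rewrite !hat_bshift_word; apply/sx/permw_mul2l. Qed.

Lemma hat_eq0 x w : x w = 0 -> hat x w = 0.
Proof. by move=> x0; rewrite /hat x0 mul0r. Qed.

Lemma hat_restr P x w : hat (restr P x) w = if P w then hat x w else 0.
Proof. by rewrite /hat restrE; case: ifP => // _; rewrite mul0r. Qed.

Lemma sym_restr (P : pred (mword n)) x :
  (forall w v, permw w v -> P w = P v) -> sym x -> sym (restr P x).
Proof. by move=> PP sx w v wv; rewrite !hat_restr (PP _ _ wv) (sx _ _ wv). Qed.

Lemma sym_trunc D x : sym x -> sym (trunc D x).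
Proof. by apply: sym_restr => w v /permw_deg ->. Qed.

Lemma sym_basis_one : sym (ell2_basis R one).
Proof.
have w1 w : (w == one) = (deg w == 0%N).
  apply/eqP/eqP => [->|]; first exact: deg_one.
  by case: (mword_case w) => [->//|[l [v ->]]]; rewrite deg_lmul.
move=> w v wv; rewrite /hat !ell2_basisE !w1 (permw_deg wv).
case: eqP => [v0|_]; last by rewrite !mul0r.
have /eqP -> : w == one by rewrite w1 (permw_deg wv) v0.
by have /eqP -> : v == one by rewrite w1 v0.
Qed.

Section Projection.
Variable x : H.

Let num w : R[i] := \sum_(v <- cls w) (beta v)%:C * x v.
Let den w : R := \sum_(v <- cls w) beta v ^+ 2.

(** The coefficient of x along the vector with coordinates [beta] on the class
    of w and 0 elsewhere. *)
Let avg w : R[i] := num w / (den w)%:C.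

Let den_gt0 w : 0 < den w.
Proof.
rewrite /den (bigD1_seq w)/=; last 2 first.
- by rewrite mem_cls permw_refl.
- exact: cls_uniq.
by rewrite ltr_pwDl ?exprn_gt0// sumr_ge0// => v _; rewrite sqr_ge0.
Qed.

Let cls_perm w v : permw w v -> perm_eq (cls w) (cls v).
Proof.
move=> wv; apply: uniq_perm; rewrite ?cls_uniq// => u; rewrite !mem_cls.
apply/idP/idP; last exact: permw_trans.
by apply: permw_trans; rewrite permw_sym.
Qed.

Let avg_perm w v : permw w v -> avg w = avg v.
Proof. by move=> /cls_perm wv; rewrite /avg /num /den !(perm_big _ wv). Qed.

Let cls_box D w (F : mword n -> R[i]) : (deg w < D)%N ->
  \sum_(v <- cls w) F v = \sum_(v <- box n D) (permw w v)%:R * F v.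
Proof.
move=> wD; rewrite [RHS](bigID (permw w))/= [X in _ = _ + X]big1 => [|v /negPf ->]; last first.
  by rewrite mul0r.
rewrite addr0 -[RHS]big_filter.
rewrite (perm_big [seq v <- box n D | permw w v]); last first.
  apply: uniq_perm; rewrite ?cls_uniq ?filter_uniq ?box_uniq// => v.
  rewrite mem_cls mem_filter mem_box; case: (boolP (permw w v)) => //= /permw_deg <-.
  by rewrite wD.
rewrite !big_filter; apply: eq_bigr => v wv; first by rewrite wv mul1r.
Qed.

(** On a finite box, averaging over classes is self-adjoint against class
    functions: exchange the two summations over each class. *)
Let avg_pair D (F : mword n -> R[i]) : (forall w v, permw w v -> F w = F v) ->
  \sum_(w <- box n D) x w * ((beta w)%:C * F w) =
  \sum_(w <- box n D) ((beta w)%:C * avg w) * ((beta w)%:C * F w).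
Proof.
move=> FF.
transitivity (\sum_(w <- box n D) \sum_(v <- box n D)
    (permw w v)%:R * ((beta w)%:C * (beta w)%:C * F w / (den w)%:C * ((beta v)%:C * x v))).
  rewrite exchange_big/=; apply: eq_big_seq => v; rewrite mem_box => vD.
  transitivity (((beta v)%:C * x v * F v / (den v)%:C) *
      \sum_(w <- cls v) (beta w)%:C * (beta w)%:C).
    have -> : \sum_(w <- cls v) (beta w)%:C * (beta w)%:C = (den v)%:C.
      by rewrite rmorph_sum/=; apply: eq_bigr => w _; rewrite rmorphXn expr2.
    rewrite mulfVK; last by rewrite -[0]/(0%:C) (inj_eq (@complexI R)) gt_eqF.
    by rewrite mulrCA mulrA.
  rewrite (cls_box _ vD) mulr_sumr; apply: eq_bigr => w _.
  rewrite permw_sym; case: (boolP (permw w v)) => [wv|_]; last by rewrite !mul0r mulr0.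
  have -> : den w = den v by rewrite /den (perm_big _ (cls_perm wv)).
  by rewrite (FF _ _ wv); ring.
apply: eq_big_seq => w; rewrite mem_box => wD.
rewrite /avg /num (cls_box _ wD) !mulr_suml mulr_sumr mulr_suml; apply: eq_bigr => v _.
by ring.
Qed.

Let py w := (beta w)%:C * avg w.

Let py_trunc D : exists y, forall w, y w = if (deg w < D)%N then py w else 0.
Proof.
exists (\sum_(w <- box n D) py w *: ell2_basis R w) => w; rewrite ell2_sumE -mem_box.
under eq_bigr do rewrite ell2Z ell2_basisE.
case: ifPn => [ir|ir].
  rewrite (bigD1_seq w) ?box_uniq//= eqxx mulr1 big1 ?addr0// => j ji.
  by rewrite eq_sym (negPf ji) mulr0.
rewrite big_seq big1// => j jr; case: eqP => [ij|]; last by rewrite mulr0.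
by rewrite ij jr in ir.
Qed.

(** The truncated projection y satisfies <x, y> = <y, y>, so the Cauchy-Schwarz
    inequality bounds its norm by that of x. *)
Let py_bound D : \sum_(w <- box n D) cabs (py w) ^+ 2 <= nrm x ^+ 2.
Proof.
have [y yE] := py_trunc D.
have yy : y = trunc D y by apply: ell2_ext => w; rewrite truncE !yE; case: ifP.
have -> : \sum_(w <- box n D) cabs (py w) ^+ 2 = nrm y ^+ 2.
  rewrite yy (nrm_restr_sum _ (box_uniq n D) (mem_box D)).
  by apply: eq_big_seq => w; rewrite mem_box yE => ->.
have xy : inner x y = inner y y.
  transitivity (inner (trunc D x) y); first by rewrite {1}yy /trunc -inner_restr.
  transitivity (inner (trunc D y) y); last by rewrite -yy.
  rewrite !inner_trunc.
  have h := avg_pair D (F := fun w => Num.conj (avg w)).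
  rewrite (eq_big_seq (fun w => x w * ((beta w)%:C * Num.conj (avg w)))); last first.
    move=> w; rewrite mem_box yE => ->; rewrite /py rmorphM/=; congr (_ * (_ * _)).
    exact/CrealP/realC_real.
  rewrite h => [|w v wv]; last by rewrite (avg_perm wv).
  apply: eq_big_seq => w; rewrite mem_box yE => ->; rewrite /py [in RHS]rmorphM/=.
  by congr (_ * (_ * _)); apply/esym/CrealP/realC_real.
have ny := nrm_ge0 y; have nx := nrm_ge0 x.
rewrite lerXn2r ?nnegrE//; have [->//|y0] := eqVneq (nrm y) 0.
rewrite -(@ler_pM2r _ (nrm y)) ?lt_def ?y0// -expr2.
by apply: le_trans (cabs_inner x y); rewrite xy inner_nrm cabsR ger0_norm ?sqr_ge0.
Qed.

(** The symmetric part of a vector is obtained by averaging its coordinates over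
    the finite classes of rearrangements, with the weights that make the
    difference orthogonal to all symmetric vectors. *)
Lemma sym_projection : exists2 y, sym y & forall z : H, sym z -> inner (x - y) z = 0.
Proof.
have sy : square_summable py.
  apply: square_summable_bound => r ur; have [D rD] := sub_box r.
  apply: le_trans (py_bound D); apply: ler_sum_subset => //; first exact: box_uniq.
  by move=> w; exact: sqr_ge0.
exists (to_ell2 py).
  move=> w v wv; rewrite /hat to_ell2E// /py ![_%:C * _]mulrC !mulfK//.
  exact: avg_perm.
move=> z sz; apply: inner0_trunc => D; rewrite -inner_restr -/(trunc _ _).
have h := avg_pair D (F := fun w => Num.conj (hat z w)).
rewrite -[trunc D _]/(trunc D (x - to_ell2 py)) inner_trunc.
under eq_bigr do rewrite ell2B to_ell2E// mulrBl.
rewrite big_split/= sumrN.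
have cv w : Num.conj (z w) = (beta w)%:C * Num.conj (hat z w).
  by rewrite -[in LHS]hatK rmorphM/=; congr (_ * _); exact/CrealP/realC_real.
under eq_bigr do rewrite cv; rewrite h => [|w u wu]; last by rewrite (sz _ _ wu).
by under [X in _ - X]eq_bigr do rewrite cv; rewrite subrr.
Qed.

End Projection.

Section Kernels.
Variables (eps : R).
Hypothesis eps_gt0 : 0 < eps.
Let small (z : letter n -> R) := forall l, 0 <= z l <= eps.
Hypothesis kernel_summable : forall z, small z ->
  square_summable (fun w : mword n => (beta w * zmon z w)%:C).

Fact kernel_key : unit. Proof. by []. Qed.
(** The reproducing kernel at the real point z: pairing a symmetric vector with it
    evaluates the corresponding power series at z. *)
Definition kernel z : H :=
  locked_with kernel_key (to_ell2 (fun w => (beta w * zmon z w)%:C)).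

Lemma kernelE z w : small z -> kernel z w = (beta w * zmon z w)%:C.
Proof. by move=> sz; rewrite /kernel unlock to_ell2E//; exact: kernel_summable. Qed.

Lemma hat_kernel z w : small z -> hat (kernel z) w = (zmon z w)%:C.
Proof. by move=> sz; rewrite /hat kernelE// rmorphM/= mulrAC mulfV ?mul1r. Qed.

Lemma sym_kernel z : small z -> sym (kernel z).
Proof. by move=> sz w v wv; rewrite !hat_kernel// (zmon_permw _ wv). Qed.

Lemma bshift_kernel z l : small z -> bshift l (kernel z) = (z l)%:C *: kernel z.
Proof.
move=> sz; apply: hat_ext => w; rewrite hat_bshift {2}/hat ell2Z -mulrA.
by rewrite -/(hat _ _) !hat_kernel// zmon_lmul rmorphM.
Qed.

(** By induction on d the terms of exponent below d drop out of the hypothesis at t;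
    dividing by t ^ d and letting t tend to 0 isolates the term of exponent d. *)
Lemma graded_orthogonal (x y : H) (e : mword n -> nat) (yt : R -> H) :
  (forall t w, 0 < t <= 1 -> yt t w = (t ^+ e w)%:C * y w) ->
  (forall t, 0 < t <= 1 -> inner x (yt t) = 0) ->
  forall d, inner x (restr (fun w => e w == d) y) = 0.
Proof.
move=> ytE xy; elim/ltn_ind => d IH.
set A := inner x _.
have C0 : 0 <= nrm x * nrm y by rewrite mulr_ge0 ?nrm_ge0.
have At t : 0 < t <= 1 -> cabs A <= t * (nrm x * nrm y).
  move=> /[dup] tI /andP[t0 t1].
  pose z := restr (fun w => d < e w)%N (yt t).
  have ytz : yt t = \sum_(i < d.+1) (t ^+ i)%:C *: restr (fun w => e w == i) y + z.
    apply: ell2_ext => w; rewrite ell2D ell2_sumE ytE// restrE ytE//.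
    under eq_bigr do rewrite ell2Z restrE.
    case: ltnP => [dw|wd].
      rewrite big1 ?add0r// => i _; case: eqP => [wi|]; last by rewrite mulr0.
      by move: dw; rewrite wi ltnNge -ltnS ltn_ord.
    rewrite addr0 (bigD1 (Ordinal (wd : e w < d.+1)%N))//= eqxx big1 ?addr0// => i.
    by rewrite -val_eqE /= eq_sym => /negPf ->; rewrite mulr0.
  have zt : nrm z <= t ^+ d.+1 * nrm y.
    apply: (nrm_le_reindex (s := id)) => //; first by rewrite exprn_ge0// ltW.
    move=> w; rewrite restrE; case: ifP => dw; last first.
      by rewrite cabs0 mulr_ge0// exprn_ge0// ltW.
    rewrite ytE// cabsM ler_wpM2r// cabsR ger0_norm ?exprn_ge0 ?(ltW t0)//.
    by apply: ler_wiXn2l => //; exact: ltW.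
  have : inner x (yt t) = (t ^+ d)%:C * A + inner x z.
    rewrite {1}ytz innerDr big_ord_recr/= innerDr innerZr.
    have -> : inner x (\sum_(i < d) (t ^+ i)%:C *: restr (fun w => e w == i) y) = 0.
      rewrite innerC inner_suml big1 ?rmorph0// => i _.
      by rewrite innerZl innerC IH ?rmorph0 ?mulr0.
    by rewrite add0r; congr (_ * _ + _); exact/CrealP/realC_real.
  rewrite xy// => /esym/eqP; rewrite addr_eq0 => /eqP/(congr1 (@cabs R)).
  rewrite cabsM cabsR ger0_norm ?exprn_ge0 ?(ltW t0)// cabsN => tA.
  have := cabs_inner x z; rewrite -tA => h.
  rewrite -(@ler_pM2l _ (t ^+ d)) ?exprn_gt0//; apply: le_trans h _.
  apply: le_trans (ler_wpM2l (nrm_ge0 x) zt) _.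
  by rewrite exprSr le_eqVlt; apply/orP; left; apply/eqP; ring.
apply/normr0_eq0; rewrite -cabsE; suff -> : cabs A = 0 by [].
apply/eqP; rewrite eq_le cabs_ge0 andbT; apply/ler_addgt0Pr => e0 e0p; rewrite add0r.
pose c := nrm x * nrm y + 1.
have cp : 0 < c by rewrite ltr_wpDl.
have [t [tI te]] : exists t, 0 < t <= 1 /\ t * c <= e0.
  exists (Num.min 1 (e0 / c)); split.
    by rewrite lt_min ltr01 divr_gt0//= ge_min lexx.
  by rewrite -ler_pdivlMr// ge_min lexx orbT.
apply: le_trans (At t tI) _; apply: le_trans te.
by case/andP: tI => t0 _; rewrite ler_wpM2l ?(ltW t0)// /c lerDl.
Qed.

(** The identity theorem for power series in the coordinates of z: isolate the
    exponent of one variable after the other. *)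
Lemma kernel_total x : sym x -> (forall z, small z -> inner x (kernel z) = 0) -> x = 0.
Proof.
move=> sx xk.
have step (ls : seq (letter n)) (c : letter n -> nat) z : small z ->
    inner x (restr (fun w => all (fun l => cnt l w == c l) ls) (kernel z)) = 0.
  elim: ls z => [|l ls IH] z sz.
    rewrite -[RHS](xk z sz); congr (inner _ _); apply: ell2_ext => w.
    by rewrite restrE.
  pose zt t := fun l' => if l' == l then t * z l' else z l'.
  have szt t : 0 < t <= 1 -> small (zt t).
    move=> /andP[t0 t1] l'; rewrite /zt; case: eqP => // _.
    have /andP[z0 ze] := sz l'; rewrite mulr_ge0 ?(ltW t0)//=.
    by apply: le_trans ze; rewrite ler_piMl.
  pose P w := all (fun l => cnt l w == c l) ls.
  have ztE t w : 0 < t <= 1 ->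
      restr P (kernel (zt t)) w = (t ^+ cnt l w)%:C * restr P (kernel z) w.
    move=> tI; transitivity (if P w then kernel (zt t) w else 0); first exact: restrE.
    rewrite restrE; case: (P w); last by rewrite mulr0.
    rewrite (kernelE w (szt t tI)) (kernelE w sz).
    by rewrite (zmon_scale z t l w : zmon (zt t) w = _) mulrCA rmorphM.
  have := graded_orthogonal ztE (fun t tI => IH (zt t) (szt t tI)) (c l).
  by rewrite restr_restr.
(* On the class of w, x is proportional to the kernel at the constant point eps. *)
have se : small (fun=> eps) by move=> l; rewrite lexx ltW.
have ez w : zmon (fun=> eps) w = eps ^+ deg w by rewrite /zmon prodrXr.
apply: hat_ext => w; rewrite [RHS]/hat [X in X / _]/(0 : R[i]) mul0r.
pose P v := all (fun l => cnt l v == cnt l w) (enum {: letter n}).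
have PE v : P v -> permw w v.
  by move=> /allP h; apply/permwP => l; apply/esym/eqP/h; rewrite mem_enum.
pose y := restr P (kernel (fun=> eps)).
have xy : restr P x = (hat x w / (eps ^+ deg w)%:C) *: y.
  apply: ell2_ext => v; rewrite ell2Z !restrE; case: ifP => [/PE wv|]; last by rewrite mulr0.
  rewrite kernelE// ez -(permw_deg wv) (sx _ _ wv) rmorphM/= mulrCA -mulrA.
  rewrite mulVf; first by rewrite mulr1 hatK.
  by rewrite -[0]/(0%:C) (inj_eq (@complexI R)) gt_eqF// exprn_gt0.
have := step (enum {: letter n}) (fun l => cnt l w) _ se.
rewrite -/P -inner_restr xy innerZl.
have -> : inner y (kernel (fun=> eps)) = inner y y.
  have yP : restr P y = y.
    by apply: ell2_ext => v; rewrite !restrE; case: (P v).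
  transitivity (inner (restr P y) (kernel (fun=> eps))); first by rewrite yP.
  exact: inner_restr.
move=> /eqP; rewrite mulf_eq0 => /orP[|/eqP/inner_self_eq0 y0].
  rewrite mulf_eq0 => /orP[/eqP//|].
  by rewrite invr_eq0 -[0]/(0%:C) (inj_eq (@complexI R)) gt_eqF// exprn_gt0.
have : y w = 0 by rewrite y0.
have Pw : P w by apply/allP => l _.
rewrite /y restrE Pw kernelE// ez => /eqP.
by rewrite -[0]/(0%:C) (inj_eq (@complexI R)) gt_eqF// mulr_gt0// exprn_gt0.
Qed.

End Kernels.

End WeightedFock.

(** * Algebras of bounded operators *)

Section Operators.
Variables (R : realType) (H : innerProductType R).
Implicit Types (T A B : H -> H) (U : set (H -> H)).

Lemma bounded_op0 : bounded_op (fun=> 0 : H).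
Proof.
apply: bounded_op_nrm => [c x y|]; first by rewrite scaler0 addr0.
by exists 0 => x; rewrite nrm0 mul0r.
Qed.

Lemma bounded_op_id : bounded_op (@idfun H).
Proof. by apply: bounded_op_nrm => //; exists 1 => x; rewrite mul1r. Qed.

Lemma bounded_op_lin (c : R[i]) A B : bounded_op A -> bounded_op B ->
  bounded_op (fun x => c *: A x + B x).
Proof.
move=> bA bB; apply: bounded_op_nrm => [d x y|].
  rewrite bA.1 bB.1 !scalerDr !scalerA [c * d]mulrC -!addrA; congr (_ + _).
  by rewrite addrCA.
have [a a0 aA] := bounded_op_bound bA; have [b b0 bB'] := bounded_op_bound bB.
exists (cabs c * a + b) => x; apply: le_trans (nrmD _ _) _.
by rewrite mulrDl nrmZ -mulrA lerD// ler_wpM2l.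
Qed.

Lemma bounded_op_comp A B : bounded_op A -> bounded_op B -> bounded_op (A \o B).
Proof.
move=> bA bB; apply: bounded_op_nrm => [d x y|]; first by rewrite /= bB.1 bA.1.
have [a a0 aA] := bounded_op_bound bA; have [b b0 bB'] := bounded_op_bound bB.
exists (a * b) => x; apply: le_trans (aA _) _.
by rewrite -mulrA ler_wpM2l.
Qed.

Lemma bounded_op_algebra : wot_closed_algebra (@bounded_op R H).
Proof.
split=> //; split=> //; first exact: bounded_op0.
- by move=> c A B; exact: bounded_op_lin.
- exact: bounded_op_comp.
Qed.

(** Invariance of the hyperplane orthogonal to z passes to weak limits because it
    is tested by inner products with z. An eigenvector of the adjoints of the
    generators of an algebra thus yields an invariant hyperplane for all of it. *)
Lemma orth_vector_algebra (z : H) : wot_closed_algebra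
  [set T | bounded_op T /\ forall x, inner x z = 0 -> inner (T x) z = 0].
Proof.
split; first split=> [T []//||c A B [bA zA] [bB zB]|A B [bA zA] [bB zB]].
- by split; [exact: bounded_op0 | move=> x _; exact: inner0l].
- split; first exact: bounded_op_lin.
  by move=> x xz; rewrite innerDl innerZl zA// zB// mulr0 addr0.
- by split; [exact: bounded_op_comp | move=> x xz /=; apply/zA/zB].
move=> T bT app; split=> // x xz; apply/normr0_eq0.
apply/eqP; rewrite eq_le normr_ge0 andbT; rewrite -cabsE -[0]/(0%:C) lecR.
apply/ler_addgt0Pr => e e0; rewrite add0r.
have [|A [bA zA] /(_ (x, z))] := app [:: (x, z)] e%:C; first by rewrite ltcR.
rewrite inE eqxx /= => /(_ isT); rewrite innerBl (zA x xz) subr0.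
by rewrite -cabsE ltcR => /ltW.
Qed.

Lemma op_algebra_sum U (I : Type) (r : seq I) (c : I -> R[i]) (F : I -> H -> H) :
  operator_algebra U -> (forall i, U (F i)) ->
  U (fun x => \sum_(i <- r) c i *: F i x).
Proof.
move=> [_ U0 UD _] UF; elim: r => [|i r IH].
  by under eq_fun do rewrite big_nil.
by under eq_fun do rewrite big_cons; exact: UD.
Qed.

Lemma linear_op0 T : linear T -> T 0 = 0.
Proof. by move=> lT; have := lT (-1) 0 0; rewrite scaler0 addr0 scaleN1r addNr. Qed.

Lemma linear_op_sum T (I : Type) (r : seq I) (c : I -> R[i]) (F : I -> H) :
  linear T -> T (\sum_(i <- r) c i *: F i) = \sum_(i <- r) c i *: T (F i).
Proof.
move=> /[dup] lT /linear_op0 T0.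
by elim: r => [|i r IH]; rewrite ?big_nil// !big_cons lT IH.
Qed.

Lemma linear_opB T x y : linear T -> T (x - y) = T x - T y.
Proof. by move=> lT; rewrite addrC -scaleN1r lT scaleN1r addrC. Qed.

Lemma linear_opZ T c x : linear T -> T (c *: x) = c *: T x.
Proof.
move=> /[dup] lT /linear_op0 T0.
by rewrite -[c *: x]addr0 lT T0 addr0.
Qed.

Lemma cabs_sum (I : Type) (r : seq I) (F : I -> R[i]) :
  cabs (\sum_(i <- r) F i) <= \sum_(i <- r) cabs (F i).
Proof.
elim: r => [|i r IH]; first by rewrite !big_nil cabs0.
by rewrite !big_cons; apply: le_trans (cabsD _ _) _; rewrite lerD2l.
Qed.

End Operators.

(** * Multiplication operators on the symmetric vectors *)

Section SymmetricShift.
Variables (R : realType) (k : nat) (n : 'I_k -> nat) (beta : mword n -> R).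
Hypothesis beta_gt0 : forall w, 0 < beta w.
Hypothesis beta_one : beta (mword_one n) = 1.
Hypothesis beta_shift :
  forall l, exists2 c, 0 <= c & forall w, beta w <= c * beta (lmul l w).
Hypothesis beta_kernel : exists2 eps, 0 < eps & forall z, (forall l, 0 <= z l <= eps) ->
  square_summable (fun w : mword n => (beta w * zmon z w)%:C).
Local Notation H := (ell2 R (mword n)).
Local Notation one := (mword_one n).
Local Notation sym := (sym beta).
Local Notation hat := (hat beta).
Local Notation bshift := (bshift beta).
Local Notation bshift_word := (bshift_word beta).

Variable K : Defs.subspace H.
Hypothesis KP : forall x : H, (K : set H) x <-> sym x.
Variable W : letter n -> H -> H.
Hypothesis W_adj : forall l x y, inner (W l x) y = inner x (bshift l y).
Local Notation KT := (subspace_type K).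
Local Notation val := (@subspace_val R H K).
Implicit Types (x y : KT) (w u : mword n) (l : letter n).

Fact lift_key : unit. Proof. by []. Qed.
Definition lift (x : H) : KT := locked_with lift_key (insubd (0 : KT) x).

Lemma liftK (x : H) : sym x -> val (lift x) = x.
Proof. by move=> sx; rewrite /lift unlock insubdK//; apply/mem_set/KP. Qed.

Lemma sym_val x : sym (val x).
Proof. by case: x => x /= /set_mem /KP. Qed.

Lemma innerK x y : inner x y = inner (val x) (val y).
Proof. by []. Qed.

Lemma nrmK x : nrm x = nrm (val x). Proof. by []. Qed.

Lemma valK_inj : injective val. Proof. exact: val_inj. Qed.

Lemma valB x y : val (x - y) = val x - val y. Proof. by []. Qed.

Lemma valKZ c x : val (c *: x) = c *: val x. Proof. by []. Qed.

Lemma K_ext x y : (forall v, inner x v = inner y v) -> x = y.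
Proof.
move=> xy; apply/subr0_eq/inner_self_eq0; rewrite innerBl.
by apply/eqP; rewrite subr_eq0 xy.
Qed.

Fact L_key : unit. Proof. by []. Qed.
Definition L l : KT -> KT := locked_with L_key (compression (W l)).

Lemma LE l : L l = compression (W l). Proof. by rewrite /L unlock. Qed.

Definition vac : KT := lift (ell2_basis R one).

Lemma val_vac : val vac = ell2_basis R one.
Proof. exact/liftK/sym_basis_one. Qed.

Definition adjL l x : KT := lift (bshift l (val x)).

Lemma val_adjL l x : val (adjL l x) = bshift l (val x).
Proof. exact/liftK/sym_bshift/sym_val. Qed.

Definition adjLw u x : KT := lift (bshift_word u (val x)).

Lemma val_adjLw u x : val (adjLw u x) = bshift_word u (val x).
Proof. exact/liftK/sym_bshift_word/sym_val. Qed.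

(** Symmetric vectors are stable under the adjoint of W, so the projection in the
    compression is invisible to them. *)
Lemma L_adj l x y : inner (L l x) y = inner x (adjL l y).
Proof.
have [z sz xz] := sym_projection beta_gt0 (W l (val x)).
have : inner (W l (val x) - val (L l x)) (val y) = 0.
  rewrite LE /compression /orth_proj; case: xgetP => [_ -> /=|].
    by apply; apply/KP/sym_val.
  move=> /(_ (lift z)) /=; rewrite liftK// => h; exfalso; apply: h => v /KP; exact: xz.
rewrite innerBl => /subr0_eq h.
by rewrite [inner x _]innerK val_adjL -W_adj h.
Qed.

Lemma L_bounded l : bounded_op (L l).
Proof.
apply: bounded_op_nrm => [c x y|].
  by apply: K_ext => v; rewrite L_adj !innerDl !innerZl !L_adj.
have [c c0 bc] := nrm_bshift beta_gt0 beta_shift l; exists c => x.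
have [->|nz] := eqVneq (nrm (L l x)) 0; first by rewrite mulr_ge0 ?nrm_ge0.
rewrite -(@ler_pM2r _ (nrm (L l x))) ?lt_def ?nz ?nrm_ge0// -expr2.
have -> : nrm (L l x) ^+ 2 = cabs (inner (L l x) (L l x)).
  by rewrite inner_nrm cabsR ger0_norm ?sqr_ge0.
rewrite L_adj; apply: le_trans (cabs_inner _ _) _.
rewrite [c * _]mulrC -mulrA ler_wpM2l ?nrm_ge0//.
by have := bc (val (L l x)); rewrite -val_adjL.
Qed.

Let generators : set (KT -> KT) := [set T | T = idfun \/ exists l, T = L l].
Let algebra : set (KT -> KT) := smallest (@wot_closed_algebra R KT) generators.

Lemma algebra_min U : wot_closed_algebra U -> U idfun -> (forall l, U (L l)) ->
  algebra `<=` U.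
Proof.
move=> wU U1 UL T; apply; split => // A [->//|[l ->]]; exact: UL.
Qed.

Lemma algebra_bounded : algebra `<=` @bounded_op R KT.
Proof.
apply: algebra_min; [exact: bounded_op_algebra|exact: bounded_op_id|exact: L_bounded].
Qed.

(** Stated for any property of operators closed under composition with the
    compressions: it is used for membership in an algebra together with
    commutation with T. *)
Lemma word_operator (P : set (KT -> KT)) : P idfun ->
  (forall l B, P B -> P (L l \o B)) ->
  forall u, exists B, P B /\ forall x y, inner (B x) y = inner x (adjLw u y).
Proof.
move=> P1 PL; elim/mword_ind => [|l u [B [PB Bu]]].
  exists idfun; split=> // x y; congr (inner _ _); apply: valK_inj.
  by rewrite val_adjLw bshift_word_one.
exists (L l \o B); split=> [|x y]; first exact: PL.
rewrite /= L_adj Bu; congr (inner _ _); apply: valK_inj.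
by rewrite !val_adjLw val_adjL bshift_word_lmul.
Qed.

Section AlgLat.
Variable T : KT -> KT.
Hypothesis TA : Alg (Lat algebra) T.

Let T_bounded : bounded_op T. Proof. by case: TA. Qed.
Let T_linear : linear T. Proof. by case: T_bounded. Qed.

Lemma AlgLat_eigen (z : KT) : (forall l, exists c, forall x, inner (L l x) z = c * inner x z) ->
  forall x, inner x z = 0 -> inner (T x) z = 0.
Proof.
move=> zL; case: TA => _ /(_ [set x | inner x z = 0]); apply; split.
  exact: closed_subspace_inner.
move=> A; have [UA _] := orth_vector_algebra z.
move=> /(algebra_min (orth_vector_algebra z)); case.
- by split=> //; exact: bounded_op_id.
- move=> l; split; first exact: L_bounded.
  by move=> x xz; have [c ->] := zL l; rewrite xz mulr0.
- by move=> _.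
Qed.

(** T multiplies functions by the symbol T 1: its adjoint has the kernels as
    eigenvectors, so it commutes with the other multipliers. *)
Lemma AlgLat_commute l x : T (L l x) = L l (T x).
Proof.
have [eps eps0 ks] := beta_kernel.
pose ker z := lift (kernel beta z).
have vker z : (forall l, 0 <= z l <= eps) -> val (ker z) = kernel beta z.
  by move=> sz; apply: liftK; apply: sym_kernel ks z sz.
have Lker z l' y : (forall l, 0 <= z l <= eps) ->
    inner (L l' y) (ker z) = (z l')%:C * inner y (ker z).
  move=> sz; rewrite L_adj; have -> : adjL l' (ker z) = (z l')%:C *: ker z.
    apply: valK_inj; rewrite val_adjL vker//= (bshift_kernel beta_gt0 beta_shift ks)//.
    by rewrite /= -vker.
  by rewrite innerZr; congr (_ * _); exact/CrealP/realC_real.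
have ker1 z : (forall l, 0 <= z l <= eps) -> inner vac (ker z) = 1.
  move=> sz; rewrite innerK val_vac inner_basisl vker// (kernelE ks)//.
  by rewrite beta_one zmon_one mulr1 rmorph1.
have Tker z y : (forall l, 0 <= z l <= eps) ->
    inner (T y) (ker z) = inner y (ker z) * inner (T vac) (ker z).
  (* y minus its value at z, times 1, is orthogonal to the kernel at z. *)
  move=> sz; have := @AlgLat_eigen (ker z).
  move=> /(_ _ (y - inner y (ker z) *: vac)).
  rewrite innerBl innerZl ker1// mulr1 subrr => h.
  apply/subr0_eq; rewrite -h//; last by move=> l'; exists (z l')%:C => y'; exact: Lker.
  by rewrite linear_opB// innerBl linear_opZ// innerZl.
apply/subr0_eq/valK_inj.
apply: (kernel_total beta_gt0 eps0 ks); first exact: sym_val.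
move=> z sz; rewrite -vker// -innerK innerBl (Tker z (L l x))// !Lker// (Tker z x)//.
by rewrite mulrA subrr.
Qed.

Variable U : set (KT -> KT).
Hypotheses (U_algebra : operator_algebra U) (U1 : U idfun) (UL : forall l, U (L l)).

Lemma word_operators : exists Lw : mword n -> KT -> KT,
  [/\ forall u, U (Lw u), forall u x, T (Lw u x) = Lw u (T x)
    & forall u x y, inner (Lw u x) y = inner x (adjLw u y)].
Proof.
have [_ _ _ UM] := U_algebra.
pose P (B : KT -> KT) := U B /\ forall x, T (B x) = B (T x).
have PL l B : P B -> P (L l \o B).
  by move=> [UB TB]; split=> [|x]; [exact: UM | rewrite /= AlgLat_commute TB].
have /choice[Lw LwP] := word_operator (conj U1 (fun=> erefl) : P idfun) PL.
exists Lw; split=> [u|u x|u x y]; have [[UB TB] aB] := LwP u; [exact: UB|exact: TB|exact: aB].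
Qed.
Section Fejer.
Variable Lw : mword n -> KT -> KT.
Hypothesis LwU : forall u, U (Lw u).
Hypothesis TLw : forall u x, T (Lw u x) = Lw u (T x).
Hypothesis Lw_adj : forall u x y, inner (Lw u x) y = inner x (adjLw u y).

Let fin G x : Prop := forall w, (G <= deg w)%N -> val x w = 0.

(** The coefficients that express T 1 through the operators [Lw u] applied to 1. *)
Definition symbol u : R[i] := val (T vac) u * (beta u)%:C.

Let coef x y w u : R[i] :=
  (val x w * (beta w)%:C) * symbol u * Num.conj (hat (val y) (mword_mul w u)).

Let conj_val x w : Num.conj (val x w) = (beta w)%:C * Num.conj (hat (val x) w).
Proof. by rewrite -[in LHS](hatK beta_gt0) rmorphM/=; congr (_ * _); exact/CrealP/realC_real. Qed.

Let adjLwE u x w : val (adjLw u x) w = (beta w)%:C * hat (val x) (mword_mul u w).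
Proof. by rewrite val_adjLw bshift_wordE. Qed.

Let conj_adjLw u x w : Num.conj (val (adjLw u x) w) =
  (beta w)%:C * Num.conj (hat (val x) (mword_mul u w)).
Proof. by rewrite adjLwE rmorphM/=; congr (_ * _); exact/CrealP/realC_real. Qed.

(** The vector [Lw w vac] is the projection of the monomial e_w / beta(w); expand x
    in the orthonormal basis and project. *)
Lemma vac_expansion G x : fin G x ->
  x = \sum_(w <- box n G) (val x w * (beta w)%:C) *: Lw w vac.
Proof.
move=> fx; apply: K_ext => v; rewrite inner_suml innerK (inner_finl _ fx).
apply: eq_bigr => w _; rewrite innerZl Lw_adj innerK val_vac inner_basisl.
by rewrite conj_adjLw mulw1 beta_one mul1r -mulrA conj_val.
Qed.

Let fin_adjLw G u y : fin G y -> fin G (adjLw u y).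
Proof.
move=> fy w Gw; rewrite adjLwE hat_eq0 ?mulr0//; apply: fy.
by rewrite deg_mul (leq_trans Gw)// leq_addl.
Qed.

Lemma T_expansion G x y : fin G x -> fin G y ->
  inner (T x) y = \sum_(w <- box n G) \sum_(u <- box n G) coef x y w u.
Proof.
move=> fx fy; rewrite {1}(vac_expansion fx) linear_op_sum// inner_suml.
apply: eq_bigr => w _; rewrite innerZl TLw Lw_adj innerK (inner_finr _ (fin_adjLw w fy)).
by rewrite mulr_sumr; apply: eq_bigr => u _; rewrite conj_adjLw /coef /symbol !mulrA.
Qed.

Definition restrK P x : KT := lift (restr P (val x)).

Let Tblock_expansion (Q : pred nat) G x y : fin G x -> fin G y ->
  inner (T (restrK (Q \o @deg k n) x)) (restrK (Q \o @deg k n) y) =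
  \sum_(w <- box n G) \sum_(u <- box n G)
    (Q (deg w) && Q (deg w + deg u)%N)%:R * coef x y w u.
Proof.
have PP w v : permw w v -> (Q \o @deg k n) w = (Q \o @deg k n) v.
  by move=> /permw_deg /= ->.
have vr z : val (restrK (Q \o @deg k n) z) = restr (Q \o @deg k n) (val z).
  exact: liftK (sym_restr PP (sym_val z)).
have fr z : fin G z -> fin G (restrK (Q \o @deg k n) z).
  by move=> fz w Gw; rewrite vr restrE fz//; case: ifP.
move=> fx fy; rewrite (T_expansion (fr _ fx) (fr _ fy)).
apply: eq_bigr => w _; apply: eq_bigr => u _.
rewrite /coef !vr restrE hat_restr /= deg_mul.
by case: (Q (deg w)); case: (Q _) => /=; rewrite ?rmorph0 ?mul0r ?mulr0 ?mul1r.
Qed.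

(** The Fejer mean of order D: the homogeneous part of degree d of the symbol is
    damped by 1 - d / D. *)
Definition fejer D x : KT :=
  \sum_(u <- box n D) (((D - deg u)%N%:R / D%:R)%:C * symbol u) *: Lw u x.

Lemma fejer_mem D : U (fejer D).
Proof. exact: op_algebra_sum. Qed.

Let fejer_expansion D G x y : (D <= G)%N -> fin G x -> fin G y ->
  inner (fejer D x) y = \sum_(w <- box n G) \sum_(u <- box n G)
    ((D - deg u)%N%:R / D%:R)%:C * coef x y w u.
Proof.
move=> DG fx fy; rewrite exchange_big/= (big_box_le DG); last first.
  by move=> u Du; rewrite big1// => w _; rewrite (eqP Du) !mul0r.
rewrite inner_suml; apply: eq_bigr => u _; rewrite innerZl Lw_adj innerK.
rewrite (inner_finl _ fx) mulr_sumr; apply: eq_bigr => w _; rewrite conj_adjLw /coef.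
by rewrite (sym_val y (permw_mulC u w)); ring.
Qed.

Let sum_interval N a b :
  (\sum_(0 <= t < N) (a <= t < b) = minn b N - a)%N.
Proof.
elim: N => [|N IH]; first by rewrite big_nil minn0.
by rewrite big_nat_recr//= IH; case: (leqP a N); case: (ltnP N b) => /=; lia.
Qed.

Let window D t : pred nat := fun g => (g <= t < g + D)%N.

Let sum_window D G g h : (g < G)%N ->
  (\sum_(0 <= t < G + D) (window D t g && window D t (g + h)) = D - h)%N.
Proof.
move=> gG; transitivity (minn (g + D) (G + D) - (g + h))%N; last lia.
rewrite -sum_interval; apply: eq_bigr => t _; congr nat_of_bool.
rewrite /window; lia.
Qed.

Let blockK D t x : KT := restrK (window D t \o @deg k n) x.

(** The number of windows of D consecutive degrees that contain two degrees at
    distance d is D - d, which is D times the Fejer coefficient. *)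
Let fejer_window D G x y : (0 < D)%N -> (D <= G)%N -> fin G x -> fin G y ->
  D%:R * inner (fejer D x) y =
  \sum_(0 <= t < G + D) inner (T (blockK D t x)) (blockK D t y).
Proof.
move=> D0 DG fx fy; under [RHS]eq_bigr do rewrite (Tblock_expansion _ fx fy).
rewrite (fejer_expansion DG fx fy) [RHS]exchange_big/= mulr_sumr.
apply: eq_big_seq => w; rewrite mem_box => wG.
rewrite [RHS]exchange_big/= mulr_sumr; apply: eq_bigr => u _.
rewrite -mulr_suml -natr_sum sum_window// rmorphM/= fmorphV/= !rmorph_nat mulrA.
by rewrite [D%:R * _]mulrCA mulfV ?mulr1// pnatr_eq0 -lt0n.
Qed.

Let sum_nrm_block D G x : fin G x ->
  \sum_(0 <= t < G + D) nrm (blockK D t x) ^+ 2 = D%:R * nrm x ^+ 2.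
Proof.
move=> fx.
have nf z : fin G z -> nrm z ^+ 2 = \sum_(w <- box n G) cabs (val z w) ^+ 2.
  move=> fz; rewrite nrmK -{1}(trunc_id fz).
  exact: nrm_restr_sum (box_uniq n G) (mem_box G).
have PP t w v : permw w v -> (window D t \o @deg k n) w = (window D t \o @deg k n) v.
  by move=> /permw_deg /= ->.
have vr t z : val (blockK D t z) = restr (window D t \o @deg k n) (val z).
  exact: liftK (sym_restr (PP t) (sym_val z)).
have fr t : fin G (blockK D t x).
  by move=> w Gw; rewrite vr restrE fx//; case: ifP.
under eq_bigr do rewrite nf//.
rewrite exchange_big/= nf// mulr_sumr; apply: eq_big_seq => w; rewrite mem_box => wG.
rewrite -[D in RHS]subn0 -(sum_window D 0 wG) natr_sum mulr_suml; apply: eq_bigr => t _.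
rewrite vr restrE /= addn0 andbb; case: (window _ _ _); first by rewrite mul1r.
by rewrite cabs0 expr0n mul0r.
Qed.

Variable C : R.
Hypotheses (C0 : 0 <= C) (TC : forall x, nrm (T x) <= C * nrm x).

Let fejer_bound_sqr D G x y : (0 < D)%N -> (D <= G)%N -> fin G x -> fin G y ->
  cabs (inner (fejer D x) y) <= C / 2 * (nrm x ^+ 2 + nrm y ^+ 2).
Proof.
move=> D0 DG fx fy; have Dp : 0 < D%:R :> R by rewrite ltr0n.
rewrite -(ler_pM2l Dp).
have -> : D%:R * cabs (inner (fejer D x) y) = cabs (D%:R * inner (fejer D x) y).
  by rewrite cabsM -(rmorph_nat (real_complex R)) cabsR ger0_norm.
rewrite (fejer_window D0 DG fx fy); apply: le_trans (cabs_sum _ _) _.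
rewrite mulrCA mulrDr -!(sum_nrm_block D fx) -(sum_nrm_block D fy) -big_split mulr_sumr.
apply: ler_sum => t _; apply: le_trans (cabs_inner _ _) _ => /=.
apply: le_trans (ler_wpM2r (nrm_ge0 _) (TC _)) _.
move: (nrm (blockK D t x)) (nrm (blockK D t y)) => p q.
rewrite -subr_ge0 (_ : _ - _ = C / 2 * (p - q) ^+ 2); last by field.
by rewrite mulr_ge0 ?sqr_ge0// divr_ge0.
Qed.

Let fejer_bound_fin D G x y : (0 < D)%N -> (D <= G)%N -> fin G x -> fin G y ->
  cabs (inner (fejer D x) y) <= C * nrm x * nrm y.
Proof.
move=> D0 DG fx fy.
have [x0|x0] := eqVneq (nrm x) 0.
  rewrite x0 mulr0 mul0r (nrm0_eq0 x0) /fejer inner_suml big1 ?cabs0// => u _.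
  by rewrite innerZl Lw_adj inner0l mulr0.
have [y0|y0] := eqVneq (nrm y) 0.
  by rewrite y0 mulr0 (nrm0_eq0 y0) inner0r cabs0.
have fejZ c z v : inner (fejer D (c *: z)) v = c * inner (fejer D z) v.
  rewrite /fejer !inner_suml mulr_sumr; apply: eq_bigr => u _.
  by rewrite !innerZl !Lw_adj innerZl mulrCA.
have fZ c z : fin G z -> fin G (c *: z).
  by move=> fz w Gw; rewrite valKZ ell2Z fz// mulr0.
(* Normalizing both vectors turns the sum of squares into a product. *)
have := fejer_bound_sqr D0 DG (fZ (nrm x)^-1%:C _ fx) (fZ (nrm y)^-1%:C _ fy).
rewrite fejZ innerZr !cabsM cabs_conj !nrmZ !cabsR !ger0_norm ?invr_ge0 ?nrm_ge0//.
rewrite !mulVf// !expr1n mulrA.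
have -> : C / 2 * (1 + 1) = C by field.
move: (cabs _) => c.
have nx : 0 < nrm x by rewrite lt_def x0 nrm_ge0.
have ny : 0 < nrm y by rewrite lt_def y0 nrm_ge0.
rewrite -mulrA [_^-1 * c]mulrC mulrA ler_pdivrMr// ler_pdivrMl//.
by rewrite mulrCA mulrA.
Qed.

Let truncK G x : KT := lift (trunc G (val x)).

Let val_truncK G x : val (truncK G x) = trunc G (val x).
Proof. exact/liftK/sym_trunc/sym_val. Qed.

Let fin_truncK G G' x : (G <= G')%N -> fin G' (truncK G x).
Proof.
move=> GG' w Gw; rewrite val_truncK truncE ltnNge.
by rewrite (leq_trans GG' Gw).
Qed.

Let truncK_approx x (e : R) : 0 < e ->
  exists G0, forall G, (G0 <= G)%N -> nrm (x - truncK G x) <= e.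
Proof.
move=> /(trunc_approx (val x))[G0 h]; exists G0 => G /h.
by rewrite nrmK valB val_truncK.
Qed.

Let nrm_truncK G x : nrm (truncK G x) <= nrm x.
Proof. by rewrite nrmK val_truncK nrm_restr. Qed.

Let fejer_bounded D : bounded_op (fejer D).
Proof.
have [UB _ _ _] := U_algebra; exact/UB/fejer_mem.
Qed.

Lemma fejer_bound D x y : (0 < D)%N ->
  cabs (inner (fejer D x) y) <= C * nrm x * nrm y.
Proof.
move=> D0; have [q q0 bq] := bounded_op_bound (fejer_bounded D).
apply/ler_addgt0Pr => e e0.
pose s := q * (nrm x + nrm y) + 1.
have sp : 0 < s by rewrite ltr_wpDl// mulr_ge0// addr_ge0 ?nrm_ge0.
have es : 0 < e / s by rewrite divr_gt0.
have [G1 h1] := truncK_approx x es; have [G2 h2] := truncK_approx y es.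
pose G := maxn D (maxn G1 G2).
have {}h1 := h1 G (leq_trans (leq_maxl G1 G2) (leq_maxr _ _)).
have {}h2 := h2 G (leq_trans (leq_maxr G1 G2) (leq_maxr _ _)).
have DG : (D <= G)%N by exact: leq_maxl.
have -> : inner (fejer D x) y = inner (fejer D (truncK G x)) (truncK G y) +
    (inner (fejer D (x - truncK G x)) y + inner (fejer D (truncK G x)) (y - truncK G y)).
  rewrite (linear_opB _ _ (fejer_bounded D).1) innerBl innerBr.
  by ring.
apply: le_trans (cabsD _ _) _; apply: lerD.
  apply: le_trans (fejer_bound_fin D0 DG (fin_truncK _ (leqnn G)) (fin_truncK _ (leqnn G))) _.
  by rewrite -!mulrA ler_wpM2l// ler_pM ?nrm_ge0// nrm_truncK.
apply: le_trans (cabsD _ _) _.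
apply: (@le_trans _ _ (q * (e / s) * nrm y + q * nrm x * (e / s))).
  apply: lerD; apply: le_trans (cabs_inner _ _) _.
    apply: ler_pM; rewrite ?nrm_ge0//; apply: le_trans (bq _) _.
    rewrite ler_wpM2l; [exact: isT|exact: q0|exact: h1].
  apply: ler_pM; rewrite ?nrm_ge0//; apply: le_trans (bq _) _.
  by rewrite ler_wpM2l// nrm_truncK.
have -> : q * (e / s) * nrm y + q * nrm x * (e / s) = (e / s) * (s - 1).
  by rewrite /s; ring.
by rewrite mulrBr mulr1 divfK ?gt_eqF// gerBl ltW.
Qed.

Let fejer_fin_cvg G x y (e : R) : 0 < e -> fin G x -> fin G y ->
  exists D0, forall D, (D0 <= D)%N -> cabs (inner (T x - fejer D x) y) <= e.
Proof.
move=> e0 fx fy.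
pose M := \sum_(w <- box n G) \sum_(u <- box n G) G%:R * cabs (coef x y w u).
have M0 : 0 <= M by do 2![apply: sumr_ge0 => ? _]; rewrite mulr_ge0.
have [N hN] : exists N, M / e <= N%:R.
  by exists (Num.bound (M / e)); apply/ltW/archi_boundP; rewrite divr_ge0// ltW.
exists (maxn N.+1 G) => D; rewrite geq_max => /andP[ND GD].
have finS z : fin G z -> fin D z by move=> fz w Dw; apply: fz; exact: leq_trans Dw.
have Dp : 0 < D%:R :> R by rewrite ltr0n (leq_trans _ ND).
rewrite innerBl (T_expansion fx fy) (fejer_expansion (leqnn D) (finS _ fx) (finS _ fy)).
rewrite (big_box_le GD) => [|w Gw]; last first.
  by rewrite big1// => u _; rewrite /coef fx// !mul0r mulr0.
have -> : \sum_(w <- box n G) \sum_(u <- box n G) coef x y w u -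
   \sum_(w <- box n G) \sum_(u <- box n D) ((D - deg u)%N%:R / D%:R)%:C * coef x y w u =
   \sum_(w <- box n G) \sum_(u <- box n G) ((deg u)%:R / D%:R)%:C * coef x y w u.
  rewrite -sumrB; apply: eq_bigr => w _.
  rewrite [X in _ - X](big_box_le GD) => [|u Gu]; last first.
    rewrite /coef hat_eq0 ?rmorph0 ?mulr0//; apply: fy.
    by rewrite deg_mul (leq_trans Gu)// leq_addl.
  rewrite -sumrB; apply: eq_big_seq => u; rewrite mem_box => uG.
  rewrite natrB; last exact: leq_trans (ltnW uG) GD.
  rewrite mulrBl mulfV ?gt_eqF// rmorphB rmorph1 mulrBl mul1r opprB.
  by rewrite addrC subrK.
apply: le_trans (cabs_sum _ _) _.
apply: (@le_trans _ _ (M / D%:R)); last first.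
  rewrite ler_pdivrMr// -ler_pdivrMl// mulrC; apply: le_trans hN _.
  by rewrite ler_nat (leq_trans _ ND).
rewrite /M mulr_suml; apply: ler_sum => w _; apply: le_trans (cabs_sum _ _) _.
rewrite mulr_suml !big_seq; apply: ler_sum => u; rewrite mem_box => uG.
rewrite cabsM mulrAC ler_wpM2r// cabsR ger0_norm ?divr_ge0//.
by rewrite ler_wpM2r ?invr_ge0// ler_nat ltnW.
Qed.

(** The uniform bound reduces the convergence to vectors of finite degree. *)
Lemma fejer_cvg x y (e : R) : 0 < e ->
  exists D0, forall D, (D0 <= D)%N -> cabs (inner (T x - fejer D x) y) < e.
Proof.
move=> e0; have e3 : e / 3 + e / 3 < e by lra.
pose s := 2 * C * (nrm x + nrm y) + 1.
have sp : 0 < s by rewrite ltr_wpDl// !mulr_ge0// addr_ge0 ?nrm_ge0.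
have es : 0 < e / 3 / s by rewrite !divr_gt0.
have [G1 h1] := truncK_approx x es; have [G2 h2] := truncK_approx y es.
pose G := maxn G1 G2.
have {}h1 := h1 G (leq_maxl _ _); have {}h2 := h2 G (leq_maxr _ _).
have [|D0 h] := @fejer_fin_cvg G (truncK G x) (truncK G y) (e / 3) _
  (fin_truncK _ (leqnn G)) (fin_truncK _ (leqnn G)); first by rewrite divr_gt0.
exists D0.+1 => D D0D; have {}h := h D (ltnW D0D).
have Dp : (0 < D)%N by exact: leq_trans D0D.
have dif z v : cabs (inner (T z - fejer D z) v) <= 2 * C * nrm z * nrm v.
  rewrite innerBl; apply: le_trans (cabsD _ _) _; rewrite cabsN.
  have := fejer_bound z v Dp.
  have : cabs (inner (T z) v) <= C * nrm z * nrm v.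
    by apply: le_trans (cabs_inner _ _) _; rewrite ler_wpM2r; [exact: isT|exact: nrm_ge0|exact: TC].
  rewrite -!mulrA mulr2n mulrDl mul1r => ? ?; exact: lerD.
have -> : inner (T x - fejer D x) y =
    inner (T (truncK G x) - fejer D (truncK G x)) (truncK G y) +
    (inner (T (x - truncK G x) - fejer D (x - truncK G x)) y +
     inner (T (truncK G x) - fejer D (truncK G x)) (y - truncK G y)).
  rewrite (linear_opB _ _ (fejer_bounded D).1) (linear_opB _ _ T_linear).
  by rewrite !(innerBl, innerBr); ring.
apply: le_lt_trans (cabsD _ _) _.
have hd : cabs (inner (T (x - truncK G x) - fejer D (x - truncK G x)) y +
     inner (T (truncK G x) - fejer D (truncK G x)) (y - truncK G y)) <= e / 3.
  apply: le_trans (cabsD _ _) _.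
  apply: (@le_trans _ _ (2 * C * (e / 3 / s) * nrm y + 2 * C * nrm x * (e / 3 / s))).
    apply: lerD; apply: le_trans (dif _ _) _.
      rewrite ler_wpM2r; [exact: isT|exact: nrm_ge0|].
      by rewrite ler_wpM2l; [exact: isT|rewrite mulr_ge0|exact: h1].
    apply: ler_pM; rewrite ?mulr_ge0 ?nrm_ge0//.
    by rewrite ler_wpM2l ?mulr_ge0// nrm_truncK.
  have -> : 2 * C * (e / 3 / s) * nrm y + 2 * C * nrm x * (e / 3 / s) =
     (e / 3 / s) * (s - 1) by rewrite /s; ring.
  by rewrite mulrBr mulr1 divfK ?gt_eqF// gerBl ltW.
exact: le_lt_trans (lerD h hd) e3.
Qed.

End Fejer.

Hypothesis U_wot : wot_closed U.

Lemma AlgLat_mem : U T.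
Proof.
have [Lw [LwU TLw aLw]] := word_operators.
have [C C0 TC] := bounded_op_bound T_bounded.
apply: U_wot => // s e e0.
have e0' : 0 < complex.Re e by move: e0; rewrite ltcE => /andP[_].
have ee : e = (complex.Re e)%:C by rewrite RRe_real// gtr0_real.
suff [D0 h] : exists D0, forall D, (D0 <= D)%N -> forall p, p \in s ->
    cabs (inner (T p.1 - fejer Lw D p.1) p.2) < complex.Re e.
  exists (fejer Lw D0); first exact: fejer_mem.
  by move=> p /(h D0 (leqnn D0)); rewrite ee -cabsE ltcR.
elim: s => [|p s [D1 h1]]; first by exists 0%N.
have [D2 h2] := fejer_cvg LwU TLw aLw C0 TC p.1 p.2 e0'.
exists (maxn D1 D2) => D; rewrite geq_max => /andP[D1D D2D] q.
by rewrite inE => /orP[/eqP ->|qs]; [exact: h2|exact: h1].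
Qed.

End AlgLat.

Lemma reflexive_symmetric_shift : reflexive_algebra algebra.
Proof.
apply/seteqP; split=> T TA.
  split; first exact: algebra_bounded.
  by move=> S [_]; apply.
move=> U [[aU wU] gU]; apply: AlgLat_mem => //; first by apply: gU; left.
by move=> l; apply: gU; right; exists l.
Qed.

End SymmetricShift.

(** * Growth of the weights *)

Section WeightGrowth.
Variables (R : realType) (n : nat) (a : seq 'I_n -> R).
Hypothesis a_pos : positive_regular a.

Let a_ge0 alpha : 0 <= a alpha. Proof. by case: a_pos. Qed.

(** A finite limit superior bounds all but finitely many of the roots, hence all
    of them, and the sum of squares of degree p dominates each of its terms. *)
Lemma regular_coef_bound : exists2 C, 0 < C &
  forall alpha, alpha != [::] -> a alpha <= C ^+ size alpha.
Proof.
pose S p := \sum_(alpha : p.-tuple 'I_n) `|a alpha| ^+ 2.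
pose r p := S p `^ (2 * p%:R)^-1.
have S0 p : 0 <= S p by apply: sumr_ge0 => ? _; rewrite sqr_ge0.
have r0 p : 0 <= r p by exact: powR_ge0.
have [N [M rM]] : exists N M, forall p, (N <= p)%N -> r p <= M.
  case: a_pos => _ _ _ /ereal_inf_lt[_ [A [N _ NA] <-]] ltA.
  exists N, (fine (ereal_sup ((fun p => (r p)%:E) @` A))) => p Np.
  have rA : ((r p)%:E <= ereal_sup ((fun p => (r p)%:E) @` A))%E.
    by apply: ereal_sup_ubound; exists p => //; exact: NA.
  rewrite -lee_fin fineK// fin_numElt ltA andbT.
  by apply: lt_le_trans rA; rewrite ltNyr.
pose C := 1 + `|M| + \sum_(i < N) r i.
have C1 : 1 <= C by rewrite /C -addrA lerDl addr_ge0 ?sumr_ge0.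
have rC p : r p <= C.
  have [Np|pN] := leqP N p.
    apply: le_trans (rM p Np) _; apply: le_trans (ler_norm _) _.
    by rewrite /C addrAC lerDr addr_ge0 ?sumr_ge0.
  rewrite /C (bigD1 (Ordinal pN))//= addrCA lerDl.
  by rewrite !addr_ge0 ?sumr_ge0.
exists C; first exact: lt_le_trans C1.
move=> alpha alpha0; set p := size alpha.
have p0 : (0 < p)%N by rewrite lt0n size_eq0.
have C0 : 0 <= C by exact: le_trans C1.
rewrite -(@ler_pXn2r _ 2)// ?nnegrE ?exprn_ge0//.
apply: (@le_trans _ _ (S p)).
  rewrite /S (bigD1 (in_tuple alpha))//= ger0_norm// lerDl.
  by apply: sumr_ge0 => ? _; rewrite sqr_ge0.
have -> : S p = r p ^+ (p * 2).
  rewrite /r -powR_mulrn ?powR_ge0// -powRrM natrM [p%:R * _]mulrC mulVf ?powRr1//.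
  by rewrite mulf_neq0// pnatr_eq0 -lt0n.
by rewrite -exprM lerXn2r// nnegrE.
Qed.

Let sum_words (C q : R) N : 0 <= C -> 0 <= q -> n%:R * (C * q) <= 8^-1 ->
  (forall alpha, alpha != [::] -> a alpha <= C ^+ size alpha) ->
  \sum_(u : N.-bseq 'I_n | (0 < size u)%N) a u * q ^+ size u <= 4^-1.
Proof.
move=> C0 q0 Cq aC.
apply: (@le_trans _ _ (\sum_(u : N.-bseq 'I_n | (0 < size u)%N) (C * q) ^+ size u)).
  apply: ler_sum => u u0; rewrite exprMn ler_wpM2r ?exprn_ge0//.
  by apply: aC; rewrite -size_eq0 -lt0n.
rewrite (reindex (@tagged_tuple_bseq N 'I_n))/=; last exact: onW_bij.
have CQ0 : 0 <= C * q by rewrite mulr_ge0.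
rewrite (eq_bigl (fun t : {d : 'I_N.+1 & d.-tuple 'I_n} => (0 < tag t)%N && true)); last first.
  by move=> [d t] /=; rewrite size_tuple andbT.
rewrite (eq_bigr (fun t : {d : 'I_N.+1 & d.-tuple 'I_n} => (C * q) ^+ tag t)); last first.
  by move=> [d t] _ /=; rewrite size_tuple.
rewrite -(sig_big_dep (fun d : 'I_N.+1 => (0 < d)%N) (fun=> xpredT)
  (fun (d : 'I_N.+1) (t : d.-tuple 'I_n) => (C * q) ^+ d))/=.
apply: (@le_trans _ _ (\sum_(d < N.+1 | (0 < d)%N) 8^-1 ^+ d)).
  apply: ler_sum => d _; rewrite sumr_const card_tuple card_ord -[leLHS]mulr_natl natrX -exprMn.
  by rewrite lerXn2r ?nnegrE ?mulr_ge0.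
rewrite big_mkcond big_ord_recl /= add0r.
suff : \sum_(i < N) (8^-1 : R) ^+ i.+1 <= 4^-1 - 4^-1 * 8^-1 ^+ N.
  move/le_trans; apply; rewrite gerBl mulr_ge0// exprn_ge0//.
elim: N => [|N IH]; first by rewrite big_ord0 expr0 mulr1 subrr.
rewrite big_ord_recr /= exprS; have : 0 <= (8^-1 : R) ^+ N by rewrite exprn_ge0.
by move: IH; move: (_ ^+ N) (\sum_(_ < N) _) => x y; lra.
Qed.

Let sum_tuple_prod (I : finType) (F : I -> R) p :
  \sum_(t : p.-tuple I) \prod_(u <- t) F u = (\sum_u F u) ^+ p.
Proof.
rewrite -[p in RHS]card_ord -prodr_const bigA_distr_bigA/=.
rewrite (reindex (fun f : {ffun 'I_p -> I} => [tuple f i | i < p])).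
  by apply: eq_bigr => f _; rewrite big_tuple; apply: eq_bigr => i _; rewrite tnth_mktuple.
exists (fun t : p.-tuple I => [ffun i => tnth t i]) => [f _|t _].
  by apply/ffunP => i; rewrite ffunE tnth_mktuple.
by apply: eq_from_tnth => i; rewrite tnth_mktuple ffunE.
Qed.

(** The factorizations of a word are bounded by all tuples of nonempty words: the
    generating series of the latter is a power of that of the coefficients. *)
Lemma weight_growth m : exists M q, [/\ 0 < q, q <= 1 &
  forall alpha, weight a m alpha * q ^+ size alpha <= M].
Proof.
have [C C0 aC] := regular_coef_bound.
(* With this q the series of the coefficients is at most 1/4, which leaves a
   factor 2 per part to absorb the binomial coefficient. *)
pose q := (8 * (n%:R * C + 1))^-1.
have nC : 0 <= n%:R * C by rewrite mulr_ge0// ltW.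
have q0 : 0 < q by rewrite invr_gt0 mulr_gt0// ltr_wpDl.
have q1 : q <= 1 by rewrite invf_le1 ?mulr_gt0 ?ltr_wpDl//; lra.
have Cq : n%:R * (C * q) <= 8^-1.
  rewrite mulrA /q invfM mulrCA ler_piMr ?invr_ge0//.
  by rewrite ler_pdivrMr ?ltr_wpDl// mul1r lerDl.
exists (2 ^+ m), q; split=> // alpha.
case: alpha => [|j alpha']; first by rewrite mulr1 exprn_ege1// ler1n.
set alpha := j :: alpha'; set N := size alpha.
have binle p : 'C(p + m - 1, m - 1)%N%:R <= 2 ^+ p * 2 ^+ m :> R.
  rewrite -exprD -[2]/(2%:R) -natrX ler_nat.
  have le2 c d : ('C(c, d) <= 2 ^ c)%N.
    elim: c d => [|c IH] [|d]; rewrite ?bin0 ?expn_gt0//.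
    by rewrite binS expnS mul2n -addnn leq_add.
  by apply: leq_trans (le2 _ _) _; rewrite leq_exp2l// leq_subr.
have fact p : \sum_(gamma : p.-tuple (N.-bseq 'I_n) | factorization gamma)
    (\prod_(u <- gamma) a u) * q ^+ N <= 4^-1 ^+ p.
  pose f (u : N.-bseq 'I_n) := if (0 < size u)%N then a u * q ^+ size u else 0.
  have f0 u : 0 <= f u by rewrite /f; case: ifP => // _; rewrite mulr_ge0 ?exprn_ge0// ltW.
  apply: (@le_trans _ _ (\sum_(gamma : p.-tuple (N.-bseq 'I_n)) \prod_(u <- gamma) f u)).
    rewrite [leRHS](bigID (fun gamma : p.-tuple (N.-bseq 'I_n) => factorization gamma))/=.
    rewrite -[leLHS]addr0 lerD//; last first.
      by apply: sumr_ge0 => g _; exact: prodr_ge0.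
    apply: ler_sum => g /andP[/eqP fg /allP ag].
    rewrite [leRHS](eq_big_seq (fun u : N.-bseq 'I_n => a u * q ^+ size u)); last first.
      by move=> u ug; rewrite /f ag.
    suff sg : (\sum_(u <- g) size u)%N = N by rewrite big_split/= prodrXr sg.
    by have := congr1 size fg; rewrite size_flatten sumnE !big_map.
  rewrite sum_tuple_prod lerXn2r ?nnegrE ?sumr_ge0//.
  by rewrite /f -big_mkcond; exact: sum_words (ltW C0) (ltW q0) Cq aC.
apply: (@le_trans _ _ (\sum_(1 <= p < N.+1) 2^-1 ^+ p * 2 ^+ m)).
  rewrite mulr_suml; apply: ler_sum => p _; rewrite -mulr_suml mulrAC mulr_suml.
  apply: le_trans (ler_wpM2r (ler0n _ _) (fact p)) _.
  apply: le_trans (ler_wpM2l _ (binle p)) _; first by rewrite exprn_ge0.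
  rewrite mulrA -exprMn ler_wpM2r ?exprn_ge0//.
  by rewrite (_ : 4^-1 * 2 = 2^-1 :> R)//; lra.
rewrite -mulr_suml ler_piMl ?exprn_ge0//.
suff : \sum_(1 <= p < N.+1) (2^-1 : R) ^+ p <= 1 - 2^-1 ^+ N.
  by move/le_trans; apply; rewrite gerBl exprn_ge0.
elim: (N) => [|N' IH]; first by rewrite big_geq// expr0 subrr.
rewrite big_nat_recr//=; have : 0 <= (2^-1 : R) ^+ N' by rewrite exprn_ge0.
by move: IH; rewrite exprS; move: (_ ^+ N') (\sum_(1 <= _ < N'.+1) _) => x y; lra.
Qed.

End WeightGrowth.

(** * The commutator ideal and its orthogonal complement *)

Section SymmetricIdeal.
Variables (R : realType) (k : nat) (n : 'I_k -> nat).
Local Notation A := (malg (mword n) R[i]).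

(** The linear functional on polynomials with value [phi w] on the monomial w. *)
Definition pairing (phi : mword n -> R[i]) (g : A) : R[i] := mmap idfun phi g.

Lemma pairingE phi g : pairing phi g = \sum_(w <- msupp g) mcoeff w g * phi w.
Proof. exact: mmapE. Qed.

Lemma pairingD phi g h : pairing phi (g + h) = pairing phi g + pairing phi h.
Proof. exact: mmapD. Qed.

Lemma pairingB phi g h : pairing phi (g - h) = pairing phi g - pairing phi h.
Proof. exact: mmapB. Qed.

Lemma pairing_monomial phi w : pairing phi (mkmalgU w 1) = phi w.
Proof. by rewrite /pairing mmapU mul1r. Qed.

Lemma pairingM phi g h : pairing phi (g * h) =
  \sum_(u <- msupp g) mcoeff u g * pairing (fun w => phi (mword_mul u w)) h.
Proof.
rewrite malgME /pairing raddf_sum /=; apply: eq_bigr => u _.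
rewrite raddf_sum mmapE mulr_sumr; apply: eq_bigr => w _.
by rewrite [LHS]mmapU /= mulrA.
Qed.

Lemma pairing0 phi : pairing phi 0 = 0. Proof. exact: mmap0. Qed.

Lemma letter_mword (l : letter n) w :
  mword_mul (mword_set (mword_one n) [:: tagged l]) w = lmul l w.
Proof.
rewrite -[w in RHS]mul1w -lmul_mul; congr mword_mul.
by rewrite /lmul ffunE.
Qed.

Lemma Zvar_mul (l1 l2 : letter n) :
  Zvar R (tagged l1) * Zvar R (tagged l2) =
  mkmalgU (lmul l1 (lmul l2 (mword_one n))) 1 :> A.
Proof.
rewrite [LHS]fgmulUU mul1r; congr mkmalgU.
transitivity (mword_mul (mword_set (mword_one n) [:: tagged l1])
  (mword_set (mword_one n) [:: tagged l2])) => //.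
by rewrite letter_mword -[mword_set _ [:: tagged l2]]mulw1 letter_mword.
Qed.

(** A function of the letter counts does not distinguish the two monomials of a
    commutator, and its translates are again functions of the letter counts; so
    the polynomials on which all such functionals vanish form a left ideal. *)
Lemma Qc_pairing0 (g : A) phi : @Qc R k n g ->
  (forall w v, permw w v -> phi w = phi v) -> pairing phi g = 0.
Proof.
move=> Qg; move: phi; pose J := [set h : A | forall phi : mword n -> R[i],
  (forall w v, permw w v -> phi w = phi v) -> pairing phi h = 0].
suff : J g by [].
apply: Qg; split; first split=> [phi _|a x y Jx Jy phi pp]; first exact: pairing0.
  rewrite pairingD Jy// addr0 pairingM big1// => u _; rewrite Jx ?mulr0// => w v wv.
  exact/pp/permw_mul2l.
move=> _ [i [j1 [j2 ->]]] phi pp.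
rewrite pairingB (Zvar_mul (Tagged (fun i => 'I_(n i)) j1) (Tagged (fun i => 'I_(n i)) j2)).
rewrite (Zvar_mul (Tagged (fun i => 'I_(n i)) j2) (Tagged (fun i => 'I_(n i)) j1)).
rewrite !pairing_monomial; apply/eqP; rewrite subr_eq0; apply/eqP/pp/permwP => l.
by rewrite !cnt_lmul addnCA.
Qed.

Lemma Qc_swap (u : mword n) (l1 l2 : letter n) : tag l1 = tag l2 ->
  @Qc R k n (mkmalgU (mword_mul u (lmul l1 (lmul l2 (mword_one n)))) 1 -
             mkmalgU (mword_mul u (lmul l2 (lmul l1 (mword_one n)))) 1).
Proof.
case: l1 l2 => i j1 [i' j2] /= ii'; subst i' => J [[J0 JD] Jg].
pose l1 : letter n := Tagged (fun i => 'I_(n i)) j1.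
pose l2 : letter n := Tagged (fun i => 'I_(n i)) j2.
have -> : mkmalgU (mword_mul u (lmul l1 (lmul l2 (mword_one n)))) 1 -
   mkmalgU (mword_mul u (lmul l2 (lmul l1 (mword_one n)))) 1 =
   mkmalgU u 1 * (Zvar R j1 * Zvar R j2 - Zvar R j2 * Zvar R j1) + 0 :> A.
  rewrite addr0 (Zvar_mul l1 l2) (Zvar_mul l2 l1) mulrBr.
  by congr (_ - _); rewrite [RHS]fgmulUU mul1r.
by apply: JD => //; apply: Jg; exists i, j1, j2.
Qed.

End SymmetricIdeal.

(** * The weighted Fock space *)

Section ConcreteShift.
Variables (R : realType) (k : nat) (n m : 'I_k -> nat).
Variable a : forall i : 'I_k, seq 'I_(n i) -> R.
Hypotheses (a_pos : forall i, positive_regular (@a i)).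
Hypotheses (m_ge1 : forall i, (1 <= m i)%N).
Local Notation H := (ell2 R (mword n)).
Local Notation b i := (weight (@a i) (m i)).
Implicit Types (w u v : mword n) (x y : H).

Definition fock_weight w : R := \prod_(i < k) Num.sqrt (b i (w i)).
Local Notation beta := fock_weight.

Let b_gt0 i alpha : 0 < b i alpha.
Proof. exact: weight_gt0. Qed.

Lemma fock_weight_gt0 w : 0 < beta w.
Proof. by apply: prodr_gt0 => i _; rewrite sqrtr_gt0. Qed.

Lemma fock_weight_one : beta (mword_one n) = 1.
Proof. by rewrite /fock_weight big1// => i _; rewrite ffunE /weight sqrtr1. Qed.

Lemma fock_weight_lmul (l : letter n) w : beta w / beta (lmul l w) =
  Num.sqrt (b (tag l) (w (tag l)) / b (tag l) (tagged l :: w (tag l))).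
Proof.
rewrite /fock_weight (bigD1 (tag l))// [\prod_(i < k) _](bigD1 (tag l))//.
set p := \prod_(i < k | _) _; set q := \prod_(i < k | _) _.
have -> : q = p.
  by apply: eq_bigr => i il; rewrite /lmul mword_set_out// eq_sym.
have p0 : p != 0 by rewrite gt_eqF// prodr_gt0// => i _; rewrite sqrtr_gt0.
have sqrt_div (x y : R) : 0 < x -> 0 < y -> Num.sqrt (x / y) = Num.sqrt x / Num.sqrt y.
  by move=> x0 y0; rewrite sqrtrM ?(ltW x0)// sqrtrV// ltW.
rewrite /lmul mword_set_in sqrt_div ?b_gt0//=.
by rewrite invfM mulrACA mulfV// mulr1.
Qed.

Lemma fock_weight_shift (l : letter n) :
  exists2 c, 0 <= c & forall w, beta w <= c * beta (lmul l w).
Proof.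
exists (Num.sqrt (@a (tag l) [:: tagged l])^-1) => [|w]; first exact: sqrtr_ge0.
rewrite -ler_pdivrMr ?fock_weight_gt0// fock_weight_lmul.
have := shift_coef_le (a_pos (tag l)) (m_ge1 (tag l)) (tagged l) (w (tag l)).
by rewrite cabsR ger0_norm ?sqrtr_ge0.
Qed.

Local Notation bshift := (bshift beta).
Local Notation bshift_word := (bshift_word beta).
Local Notation hat := (hat beta).
Local Notation sym := (sym beta).

Let shiftE := bshiftE fock_weight_gt0 fock_weight_shift.
Let hat_shift := hat_bshift fock_weight_gt0 fock_weight_shift.

Lemma W_adjoint (l : letter n) x y :
  inner (W m a (tagged l) x) y = inner x (bshift l y).
Proof.
rewrite !inner_ell2E (csum_push (@lmul_inj _ _ l)).
  congr csum; apply/funext => w /=; rewrite WE// shiftE rmorphM/=.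
  rewrite /lmul mword_set_in eqxx mword_set_set mword_set_id -/(lmul l w).
  rewrite mulrA [x w * _]mulrC; congr (_ * _ * _).
  have -> : Num.conj ((beta w / beta (lmul l w))%:C) = (beta w / beta (lmul l w))%:C.
    exact/CrealP/realC_real.
  by rewrite fock_weight_lmul.
move=> w; rewrite WE//; case E : (w (tag l)) => [|l' alpha].
  by rewrite mul0r eqxx.
case: (l' =P tagged l) => [lj _|_]; last by rewrite mul0r eqxx.
exists (mword_set w alpha) => //.
by rewrite /lmul mword_set_in mword_set_set -lj -E mword_set_id.
Qed.

Lemma W_word_adjoint (i : 'I_k) (alpha : seq 'I_(n i)) y : exists2 z : H,
  (forall x, inner (W_word m a alpha x) y = inner x z) &
  forall w, hat z w = hat y (mword_set w (alpha ++ w i)).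
Proof.
elim: alpha y => [|j alpha IH] y.
  by exists y => // w; rewrite mword_set_id.
pose l : letter n := Tagged (fun i => 'I_(n i)) j.
have [z zy hz] := IH (bshift l y); exists z => [x|w].
  by rewrite -zy /= -(W_adjoint l).
rewrite hz hat_shift /lmul /= mword_set_in mword_set_set.
by [].
Qed.

Lemma W_mword_adjoint u x y : inner (W_mword m a u x) y = inner x (bshift_word u y).
Proof.
rewrite /W_mword.
have [z zy hz] : exists2 z : H,
    (forall x, inner (foldr (fun i T => W_word m a (u i) \o T) idfun (enum 'I_k) x) y
       = inner x z) &
    forall w, hat z w = hat y (finfun (fun i => if i \in enum 'I_k then u i ++ w i else w i)).
  elim: (enum 'I_k) (enum_uniq 'I_k) y {x} => [_|i s IH /andP[nis us]] y.
    by exists y => // w; congr hat; apply/ffunP => i; rewrite ffunE.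
  have [y' yy' hy'] := W_word_adjoint (u i) y.
  have [z zy hz] := IH us y'; exists z => [x|w]; first by rewrite /= yy' zy.
  rewrite hz hy'; congr hat; apply/ffunP => i'; rewrite [RHS]ffunE in_cons.
  have [<-|ii'] := eqVneq i i'.
    by rewrite mword_set_in ffunE (negPf nis).
  by rewrite mword_set_out// ffunE.
rewrite zy; congr (inner _ _); apply: (hat_ext fock_weight_gt0) => w.
rewrite hz (hat_bshift_word fock_weight_gt0 fock_weight_shift).
by congr hat; apply/ffunP => i; rewrite !ffunE mem_enum.
Qed.

Lemma W_eval_inner (g : malg (mword n) R[i]) x y :
  inner (W_eval m a g x) y =
  \sum_(u <- msupp g) mcoeff u g * inner x (bshift_word u y).
Proof.
rewrite /W_eval inner_suml; apply: eq_bigr => u _.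
by rewrite innerZl W_mword_adjoint.
Qed.

(** Testing x against commutators applied to basis vectors gives invariance under
    adjacent transpositions, hence under all rearrangements. Conversely the inner
    product of x with g(W) y is a pairing of g with translates of [hat x]. *)
Lemma N_Qc_sym x : subspace_set (N_Qc m a) x <-> sym x.
Proof.
have -> : subspace_set (N_Qc m a) x = (forall y, M_Qc m a y -> inner x y = 0) by [].
split=> [Nx|sx y My].
  have sw : swap_invariant (hat x).
    move=> u l1 l2 v; have [ll|ll] := eqVneq (tag l1) (tag l2); last by rewrite lmulC.
    pose g : malg (mword n) R[i] :=
      mkmalgU (mword_mul u (lmul l1 (lmul l2 (mword_one n)))) 1 -
      mkmalgU (mword_mul u (lmul l2 (lmul l1 (mword_one n)))) 1.
    have Mg : M_Qc m a (W_eval m a g (ell2_basis R v)).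
      move=> S [_]; apply; exists g; first exact: Qc_swap.
      by exists (ell2_basis R v).
    have := Nx _ Mg; rewrite innerC => /eqP; rewrite conjC_eq0 => /eqP.
    rewrite W_eval_inner.
    under eq_bigr do rewrite inner_basisl (bshift_wordE fock_weight_gt0 fock_weight_shift).
    rewrite -(pairingE (fun w => Num.conj ((beta v)%:C * hat x (mword_mul w v)))).
    rewrite /g pairingB !pairing_monomial => /subr0_eq/(can_inj conjCK)/mulfI.
    have bv : (beta v)%:C != 0.
      by rewrite -[0]/(0%:C) (inj_eq (@complexI R)) gt_eqF// fock_weight_gt0.
    move=> /(_ bv); congr (hat x _ = hat x _).
      by rewrite -mword_mulA !lmul_mul mul1w.
    by rewrite -mword_mulA !lmul_mul mul1w.
  by move=> w v; exact: swap_invariant_permw.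
suff : inner y x = 0 by move=> yx; rewrite innerC yx rmorph0.
move: y My; apply: smallest_sub; first exact: closed_subspace_inner.
move=> _ [g Qg [y _ <-]] /=; rewrite W_eval_inner.
pose z : H := \sum_(u <- msupp g) Num.conj (mcoeff u g) *: bshift_word u x.
have -> : \sum_(u <- msupp g) mcoeff u g * inner y (bshift_word u x) = inner y z.
  rewrite [RHS]innerC /z inner_suml rmorph_sum; apply: eq_bigr => u _.
  by rewrite innerZl rmorphM /= conjCK -innerC.
have -> : z = 0; last exact: inner0r.
apply: ell2_ext => w; rewrite /z ell2_sumE.
under eq_bigr do rewrite ell2Z (bshift_wordE fock_weight_gt0 fock_weight_shift).
apply: (can_inj conjCK); rewrite rmorph_sum /=.
under eq_bigr do rewrite rmorphM /= conjCK.
rewrite -(pairingE (fun u => Num.conj ((beta w)%:C * hat x (mword_mul u w)))).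
rewrite (Qc_pairing0 Qg) ?rmorph0// => u v uv; congr (Num.conj (_ * _)).
by apply: sx; apply/permwP => l; rewrite !cnt_mul; move/permwP: uv => ->.
Qed.

(** For small z the kernel vectors are square summable because the weights grow
    at most geometrically with the degree. *)
Lemma fock_weight_kernel : exists2 eps, 0 < eps & forall z, (forall l, 0 <= z l <= eps) ->
  square_summable (fun w : mword n => (beta w * zmon z w)%:C).
Proof.
have /choice[M /choice[q Mq]] i := weight_growth (a_pos i) (m i).
pose q0 := \prod_(i < k) q i.
have q00 : 0 < q0 by apply: prodr_gt0 => i _; case: (Mq i).
have q0q i : q0 <= q i.
  rewrite /q0 (bigD1 i)//= ler_piMr//; first by case: (Mq i) => /ltW.
  by apply: prodr_ile1 => j; case: (Mq j) => /ltW -> ->.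
have q01 : q0 <= 1 by apply: prodr_ile1 => j; case: (Mq j) => /ltW -> ->.
pose N : R := #|{: letter n}|%:R.
have N0 : 0 <= N by rewrite ler0n.
have growth w : beta w ^+ 2 * q0 ^+ deg w <= \prod_(i < k) M i.
  rewrite deg_sizes /fock_weight -prodrXl -prodrXr -big_split/=.
  apply: ler_prod => i _; rewrite sqr_sqrtr ?(ltW (b_gt0 _))//.
  have bi0 := ltW (b_gt0 (w i)); rewrite mulr_ge0 ?exprn_ge0 ?(ltW q00)//=.
  have [qi0 _ bM] := Mq i; apply: le_trans (bM (w i)).
  by rewrite ler_wpM2l// lerXn2r ?nnegrE// ltW.
(* The choice gives N * (eps ^ 2 / q0) <= 1 / 2, with N the number of letters. *)
pose eps := q0 / (2 * (N + 1)).
have N1 : 0 < 2 * (N + 1) by rewrite mulr_gt0// ltr_wpDl.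
have eps0 : 0 < eps by rewrite divr_gt0.
have eps1 : eps <= 1.
  by rewrite ler_pdivrMr// mul1r (le_trans q01)//; lra.
exists eps => // z sz; apply: (@square_summable_bound _ _ _ (\prod_(i < k) M i * 2)) => r ur.
have M0 : 0 <= \prod_(i < k) M i.
  by apply: le_trans (growth (mword_one n)); rewrite mulr_ge0 ?sqr_ge0// exprn_ge0// ltW.
apply: (@le_trans _ _ (\sum_(w <- r) (\prod_(i < k) M i) * (eps ^+ 2 / q0) ^+ deg w)).
  apply: ler_sum => w _; rewrite cabsR -normrX ger0_norm ?sqr_ge0// exprMn.
  have zw : zmon z w ^+ 2 <= (eps ^+ 2) ^+ deg w.
    rewrite exprAC lerXn2r ?nnegrE ?exprn_ge0 ?(ltW eps0)//; last exact: zmon_le.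
    by apply: zmon_ge0 => l; case/andP: (sz l).
  apply: le_trans (ler_wpM2l (sqr_ge0 _) zw) _.
  rewrite [(_ / q0) ^+ _]expr_div_n mulrA ler_pdivlMr ?exprn_gt0// mulrAC ler_wpM2r//.
  by rewrite !exprn_ge0// ltW.
rewrite -mulr_sumr ler_wpM2l//; apply: sum_geo_words => //.
  by rewrite divr_ge0 ?sqr_ge0// ltW.
rewrite -/N mulrA ler_pdivrMr// expr2 mulrA.
apply: (@le_trans _ _ (N * eps)).
  by rewrite ler_piMr// mulr_ge0// ltW.
rewrite /eps mulrA ler_pdivrMr// (_ : 2^-1 * q0 * (2 * (N + 1)) = N * q0 + q0).
  by rewrite lerDl ltW.
by field.
Qed.

Lemma hardy_reflexive : reflexive_algebra (hardy_algebra m a).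
Proof.
have := @reflexive_symmetric_shift R k n beta fock_weight_gt0 fock_weight_one
  fock_weight_shift fock_weight_kernel (N_Qc m a) N_Qc_sym
  (fun l => W m a (tagged l)) W_adjoint.
congr reflexive_algebra; congr smallest; apply/seteqP; split=> T.
  move=> [->|[l ->]]; first by left.
  by right; exists (tag l), (tagged l); rewrite LE.
move=> [->|[i [j ->]]]; first by left.
by right; exists (Tagged (fun i => 'I_(n i)) j); rewrite LE.
Qed.

End ConcreteShift.

Theorem corollary3p7 (R : realType) (k : nat) (n m : 'I_k -> nat)
    (a : forall i : 'I_k, seq 'I_(n i) -> R)
    (k_ge1 : (1 <= k)%N)
    (n_ge1 : forall i, (1 <= n i)%N)
    (m_ge1 : forall i, (1 <= m i)%N)
    (a_pos : forall i, positive_regular (a i)) :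
  reflexive_algebra (hardy_algebra m a).
Proof. exact: hardy_reflexive. Qed.
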